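(* Over $\mathbf{RCA}_0$, the statement that every $T_2$ locally compact CSC space has a choice of compact neighborhoods implies arithmetic transfinite recursion.
   Context: All notions are formalized in second order arithmetic. CSC space: a tuple $(X,(U_i)_{i\in\mathbb{N}},k)$ with $X\subseteq\mathbb{N}$, $(U_i)$ a sequence of subsets of $X$ such that every $x\in X$ lies in some $U_i$, and $k:X\times\mathbb{N}\times\mathbb{N}\to\mathbb{N}$ a partial function such that $x\in U_i\cap U_j$ implies $x\in U_{k(x,i,j)}\subseteq U_i\cap U_j$. $X$ is $T_2$ if any distinct points lie in disjoint basic open sets. A subspace $Y\subseteq X$ has basic open sets $U_i\cap Y$. $X$ is compact if for every $I\subseteq\mathbb{N}$ with $X=\bigcup_{i\in I}U_i$ there is a finite $a\subseteq I$ with $X=\bigcup_{i\in a}U_i$; a subset is compact if its subspace is compact. $X$ is locally compact if for every $x\in X$ there are $i\in\mathbb{N}$ and a compact $K\subseteq X$ with $x\in U_i\subseteq K$. A choice of compact neighborhoods for $X$ is a sequence $(K_x,i(x))_{x\in X}$ such that for all $x\in X$, $x\in U_{i(x)}\subseteq K_x\subseteq X$ and $K_x$ is compact. *)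

(* Defs.v *)
From mathcomp Require Import all_boot.
From mathcomp Require Import classical_sets.
Set Implicit Arguments.
Unset Strict Implicit.
Unset Printing Implicit Defensive.
Local Open Scope classical_set_scope.

(* Structures for the language of second order arithmetic, in the sense of
   Simpson, Subsystems of Second Order Arithmetic, Section I.2: the first order
   part is arbitrary (possibly nonstandard) and set quantifiers range over an
   arbitrary nonempty family of subsets of it.  "Over RCA_0, A implies B" is
   rendered as: every such structure satisfying RCA_0 and A satisfies B. *)
Record L2structure := MkL2structure {
  num : Type;
  sets : set (set num);
  zero : num;
  one : num;
  add : num -> num -> num;
  mul : num -> num -> num;
  lt : num -> num -> Prop;
  sets_nonempty : sets !=set0
}.
Arguments sets : clear implicits.

(* Formulas of L2, with de Bruijn indices: one index space for number
   variables, another one for set variables. *)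
Inductive term :=
| Var of nat | Zero | One | Add of term & term | Mul of term & term.

Inductive formula :=
| Eq of term & term
| Lt of term & term
| Mem of term & nat
| Not of formula
| And of formula & formula
| Or of formula & formula
| Imp of formula & formula
| AllNum of formula
| ExNum of formula
| AllSet of formula
| ExSet of formula.

Definition scons (T : Type) (x : T) (e : nat -> T) : nat -> T :=
  fun n => if n is n'.+1 then e n' else x.

Fixpoint eval (M : L2structure) (e : nat -> num M) (t : term) : num M :=
  match t with
  | Var n => e n
  | Zero => zero M
  | One => one M
  | Add t1 t2 => add (eval e t1) (eval e t2)
  | Mul t1 t2 => mul (eval e t1) (eval e t2)
  end.

Fixpoint sat (M : L2structure) (e : nat -> num M) (s : nat -> set (num M))
    (A : formula) : Prop :=
  match A with
  | Eq t1 t2 => eval e t1 = eval e t2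
  | Lt t1 t2 => lt (eval e t1) (eval e t2)
  | Mem t n => s n (eval e t)
  | Not B => ~ sat e s B
  | And B C => sat e s B /\ sat e s C
  | Or B C => sat e s B \/ sat e s C
  | Imp B C => sat e s B -> sat e s C
  | AllNum B => forall x : num M, sat (scons x e) s B
  | ExNum B => exists x : num M, sat (scons x e) s B
  | AllSet B => forall X : set (num M), sets M X -> sat e (scons X s) B
  | ExSet B => exists2 X : set (num M), sets M X & sat e (scons X s) B
  end.

Fixpoint lift (t : term) : term :=
  match t with
  | Var n => Var n.+1
  | Zero => Zero
  | One => One
  | Add t1 t2 => Add (lift t1) (lift t2)
  | Mul t1 t2 => Mul (lift t1) (lift t2)
  end.

(* The lift guarantees that the bound variable does not occur in the bound. *)
Definition AllBelow (t : term) (A : formula) : formula :=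
  AllNum (Imp (Lt (Var 0) (lift t)) A).
Definition ExBelow (t : term) (A : formula) : formula :=
  ExNum (And (Lt (Var 0) (lift t)) A).

Inductive Delta00 : formula -> Prop :=
| Delta00_Eq t1 t2 : Delta00 (Eq t1 t2)
| Delta00_Lt t1 t2 : Delta00 (Lt t1 t2)
| Delta00_Mem t n : Delta00 (Mem t n)
| Delta00_Not A : Delta00 A -> Delta00 (Not A)
| Delta00_And A B : Delta00 A -> Delta00 B -> Delta00 (And A B)
| Delta00_Or A B : Delta00 A -> Delta00 B -> Delta00 (Or A B)
| Delta00_Imp A B : Delta00 A -> Delta00 B -> Delta00 (Imp A B)
| Delta00_AllBelow t A : Delta00 A -> Delta00 (AllBelow t A)
| Delta00_ExBelow t A : Delta00 A -> Delta00 (ExBelow t A).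

Definition Sigma01 (A : formula) : Prop := exists2 B, Delta00 B & A = ExNum B.
Definition Pi01 (A : formula) : Prop := exists2 B, Delta00 B & A = AllNum B.

Fixpoint arithmetical (A : formula) : Prop :=
  match A with
  | Eq _ _ | Lt _ _ | Mem _ _ => True
  | Not B | AllNum B | ExNum B => arithmetical B
  | And B C | Or B C | Imp B C => arithmetical B /\ arithmetical C
  | AllSet _ | ExSet _ => False
  end.

Definition succ (M : L2structure) (n : num M) : num M := add n (one M).

Record basic_axioms (M : L2structure) : Prop := {
  succ_neq0 : forall n : num M, succ n <> zero M;
  succ_inj : forall m n : num M, succ m = succ n -> m = n;
  add_0 : forall m : num M, add m (zero M) = m;
  add_succ : forall m n : num M, add m (succ n) = succ (add m n);
  mul_0 : forall m : num M, mul m (zero M) = zero M;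
  mul_succ : forall m n : num M, mul m (succ n) = add (mul m n) m;
  not_lt_0 : forall m : num M, ~ lt m (zero M);
  lt_succ : forall m n : num M, lt m (succ n) <-> lt m n \/ m = n
}.

(* In the schemes below the environments e and s supply the number and set
   parameters. *)
Definition Sigma01_induction (M : L2structure) : Prop :=
  forall (A : formula) (e : nat -> num M) (s : nat -> set (num M)),
    Sigma01 A -> (forall i, sets M (s i)) ->
    sat (scons (zero M) e) s A ->
    (forall n, sat (scons n e) s A -> sat (scons (succ n) e) s A) ->
    forall n, sat (scons n e) s A.

Definition Delta01_comprehension (M : L2structure) : Prop :=
  forall (A B : formula) (e : nat -> num M) (s : nat -> set (num M)),
    Sigma01 A -> Pi01 B -> (forall i, sets M (s i)) ->
    (forall n, sat (scons n e) s A <-> sat (scons n e) s B) ->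
    exists2 X, sets M X & forall n, X n <-> sat (scons n e) s A.

Definition RCA0 (M : L2structure) : Prop :=
  [/\ basic_axioms M, Sigma01_induction M & Delta01_comprehension M].

(* The pairing map (m, n) |-> (m + n)^2 + m, provably injective in RCA_0 but
   not surjective. *)
Definition pair (M : L2structure) (m n : num M) : num M :=
  add (mul (add m n) (add m n)) m.

Definition triple (M : L2structure) (x i j : num M) : num M :=
  pair (pair x i) j.

(* A set S codes the sequence of sets whose i-th term is col S i. *)
Definition col (M : L2structure) (S : set (num M)) (i : num M) : set (num M) :=
  [set m | S (pair m i)].

(* (Partial) functions are coded by their graphs. *)
Definition partial_function (M : L2structure) (D E f : set (num M)) : Prop :=
  (forall p, f p -> exists a b, [/\ D a, E b & p = pair a b]) /\
  (forall a b c, f (pair a b) -> f (pair a c) -> b = c).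

Definition total_function (M : L2structure) (D E f : set (num M)) : Prop :=
  partial_function D E f /\ forall a, D a -> exists b, f (pair a b).

Definition finite (M : L2structure) (a : set (num M)) : Prop :=
  exists b, forall n, a n -> lt n b.

Record CSC_space (M : L2structure) (X U k : set (num M)) : Prop := {
  CSC_X_in : sets M X;
  CSC_U_in : sets M U;
  CSC_k_in : sets M k;
  CSC_subset : forall i, col U i `<=` X;
  CSC_cover : forall x, X x -> exists i, col U i x;
  CSC_partial : partial_function
    [set t | exists x i j, X x /\ t = triple x i j] setT k;
  CSC_meet : forall x i j, (col U i `&` col U j) x ->
    exists l, [/\ k (pair (triple x i j) l), col U l x
                & col U l `<=` col U i `&` col U j]
}.

Definition T2 (M : L2structure) (X U : set (num M)) : Prop :=
  forall x y, X x -> X y -> x <> y ->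
    exists i j, [/\ col U i x, col U j y & col U i `&` col U j = set0].

(* Compactness of the space with points X and basic open sets B i. *)
Definition compact (M : L2structure) (X : set (num M))
    (B : num M -> set (num M)) : Prop :=
  forall I, sets M I -> X = \bigcup_(i in I) B i ->
    exists a, [/\ sets M a, finite a, a `<=` I & X = \bigcup_(i in a) B i].

Definition compact_subset (M : L2structure) (U Y : set (num M)) : Prop :=
  compact Y (fun i => col U i `&` Y).

Definition locally_compact (M : L2structure) (X U : set (num M)) : Prop :=
  forall x, X x -> exists i K,
    [/\ sets M K, K `<=` X, compact_subset U K, col U i x & col U i `<=` K].

(* K codes the sequence of the K_x and f is the function x |-> i(x). *)
Definition choice_of_compact_neighborhoods (M : L2structure)
    (X U K f : set (num M)) : Prop :=
  [/\ sets M K, sets M f, total_function X setT f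
    & forall x i, X x -> f (pair x i) ->
        [/\ col U i x, col U i `<=` col K x, col K x `<=` X
          & compact_subset U (col K x)]].

Definition T2_locally_compact_have_choice (M : L2structure) : Prop :=
  forall X U k : set (num M),
    CSC_space X U k -> T2 X U -> locally_compact X U ->
    exists K f, choice_of_compact_neighborhoods X U K f.

(* Binary relations are coded by sets of pairs; a linear order is coded by its
   reflexive relation, so that its field is the set of i with (i, i) in X. *)
Definition field (M : L2structure) (X : set (num M)) : set (num M) :=
  [set i | X (pair i i)].

Definition rlt (M : L2structure) (X : set (num M)) (i j : num M) : Prop :=
  X (pair i j) /\ ~ X (pair j i).

Record linear_order (M : L2structure) (X : set (num M)) : Prop := {
  LO_refl : forall i j, X (pair i j) -> field X i /\ field X j;
  LO_trans : forall i j l, X (pair i j) -> X (pair j l) -> X (pair i l);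
  LO_antisym : forall i j, X (pair i j) -> X (pair j i) -> i = j;
  LO_total : forall i j, field X i -> field X j -> X (pair i j) \/ X (pair j i)
}.

Definition well_founded (M : L2structure) (X : set (num M)) : Prop :=
  ~ exists f, [/\ sets M f, total_function setT (field X) f
                & forall n a b, f (pair n a) -> f (pair (succ n) b) ->
                    rlt X b a].

Definition well_order (M : L2structure) (X : set (num M)) : Prop :=
  linear_order X /\ well_founded X.

(* The part of Y built strictly below j. *)
Definition below (M : L2structure) (X Y : set (num M)) (j : num M) :
    set (num M) :=
  [set p | exists m i, [/\ rlt X i j, Y (pair m i) & p = pair m i]].

(* Y is obtained by iterating along X the operator Z |-> {n | A(n, Z)}, where
   n and Z are the number and set variables of A with index 0. *)
Definition iterates (M : L2structure) (A : formula) (e : nat -> num M)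
    (s : nat -> set (num M)) (X Y : set (num M)) : Prop :=
  Y = [set p | exists n j,
        [/\ field X j, sat (scons n e) (scons (below X Y j) s) A
          & p = pair n j]].

Definition ATR (M : L2structure) : Prop :=
  forall (A : formula) (e : nat -> num M) (s : nat -> set (num M)),
    arithmetical A -> (forall i, sets M (s i)) ->
    forall X, sets M X -> well_order X ->
    exists2 Y, sets M Y & iterates A e s X Y.

(* Main.v *)
From mathcomp Require Import all_boot.
From mathcomp Require Import boolp classical_sets.
From Stdlib Require Import Ring.
Require Import Defs.
Set Implicit Arguments.
Unset Strict Implicit.
Unset Printing Implicit Defensive.
Local Open Scope classical_set_scope.

(* The choice principle is first used to get arithmetical comprehension: given a
   Delta^0_0 relation theta, the point (n,0) is the limit of the points (n,w)
   for w beyond the least witness s of theta(n,s), if there is one, and isolated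
   otherwise; a compact neighborhood of (n,0) yields a bound on s.

   Next, order the nodes of a sequence of trees T_q by extension and let the basic
   neighborhoods of a node be its cone minus the cones of finitely many children.
   Such a neighborhood is compact if no path goes through it, so that the space is
   locally compact as soon as every T_q has at most one path.  A choice of compact
   neighborhoods bounds, at each node, the label by which a path can continue;
   by Koenig's lemma the path of T_q, if it exists, is then arithmetically
   definable, uniformly in q.

   Finally, the evaluation of an arithmetical formula along a well order is a
   recursion in which the value at a vertex v is a least witness x of a condition
   depending on the value at x only, where x lies below v.  The solution below a
   given vertex is the only path of a tree.  So the solutions which exist are
   uniformly definable, and by arithmetical transfinite induction all exist. *)

(** * Definability *)

(* Since only arithmetical comprehension is at hand, transfinite induction applies to arithmetical
   properties only. That some solution below q exists is a statement about sets; that one definable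
   function [W q] is a solution below q is arithmetical. Hence the choice principle is applied to a
   single space containing all the trees T_q, so that one choice serves every q. Being a path must
   moreover be a closed condition, which truth of an existential statement is not. A value therefore
   records a least witness and not only a truth value. Uniqueness of paths enters because a basic
   neighborhood of a node can only omit the children with labels below a bound: this stops one path,
   whereas many paths could leave the node with unbounded labels. All the information is in how
   large the number m of a neighborhood must be. In the first space every point is even isolated,
   but the neighborhoods of (n,0) with m at most s are infinite and not compact, so a chosen m must
   exceed s. *)
Declare Scope num_scope.
Delimit Scope num_scope with M.
Bind Scope num_scope with num.
Notation "x + y" := (add x y) : num_scope.
Notation "x * y" := (mul x y) : num_scope.
Notation "x < y" := (lt x y) : num_scope.
Definition le (M : L2structure) (x y : num M) : Prop := lt x y \/ x = y.
Notation "x <= y" := (le x y) : num_scope.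

Definition up (f : nat -> nat) (n : nat) : nat := if n is n'.+1 then (f n').+1 else 0.

Fixpoint tren (f : nat -> nat) (t : term) : term :=
  match t with
  | Var n => Var (f n)
  | Zero => Zero
  | One => One
  | Add t1 t2 => Add (tren f t1) (tren f t2)
  | Mul t1 t2 => Mul (tren f t1) (tren f t2)
  end.

Fixpoint fren (f g : nat -> nat) (A : formula) : formula :=
  match A with
  | Eq t1 t2 => Eq (tren f t1) (tren f t2)
  | Lt t1 t2 => Lt (tren f t1) (tren f t2)
  | Mem t n => Mem (tren f t) (g n)
  | Not B => Not (fren f g B)
  | And B C => And (fren f g B) (fren f g C)
  | Or B C => Or (fren f g B) (fren f g C)
  | Imp B C => Imp (fren f g B) (fren f g C)
  | AllNum B => AllNum (fren (up f) g B)
  | ExNum B => ExNum (fren (up f) g B)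
  | AllSet B => AllSet (fren f (up g) B)
  | ExSet B => ExSet (fren f (up g) B)
  end.

Lemma tren_lift f t : tren (up f) (lift t) = lift (tren f t).
Proof. by elim: t => //= [t1 -> t2 ->|t1 -> t2 ->]. Qed.

Lemma Delta00_ren f g A : Delta00 A -> Delta00 (fren f g A).
Proof.
move=> dA; elim: dA f => /=; try by constructor.
- by move=> t B _ IH f; rewrite tren_lift; apply: Delta00_AllBelow.
- by move=> t B _ IH f; rewrite tren_lift; apply: Delta00_ExBelow.
Qed.

Section Renaming.
Variable M : L2structure.
Implicit Types (e : nat -> num M) (s : nat -> set (num M)).

Lemma scons_up (T : Type) (x : T) (e : nat -> T) f : scons x e \o up f = scons x (e \o f).
Proof. by apply/funext => -[]. Qed.

Lemma eval_ren e f t : eval e (tren f t) = eval (e \o f) t.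
Proof. by elim: t => //= [t1 -> t2 ->|t1 -> t2 ->]. Qed.

Lemma eval_lift e (x : num M) t : eval (scons x e) (lift t) = eval e t.
Proof. by elim: t => //= [t1 -> t2 ->|t1 -> t2 ->]. Qed.

Lemma sat_ren e s f g A : sat e s (fren f g A) <-> sat (e \o f) (s \o g) A.
Proof.
elim: A e s f g => /=; try by move=> *; rewrite ?eval_ren.
- by move=> B IH *; rewrite IH.
- by move=> B IHB C IHC *; rewrite IHB IHC.
- by move=> B IHB C IHC *; rewrite IHB IHC.
- by move=> B IHB C IHC *; rewrite IHB IHC.
- by move=> B IH e s f g; split=> H x; move: (H x); rewrite IH scons_up.
- by move=> B IH e s f g; split=> -[x H]; exists x; move: H; rewrite IH scons_up.
- by move=> B IH e s f g; split=> H X sX; move: (H X sX); rewrite IH scons_up.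
- by move=> B IH e s f g; split=> -[X sX H]; exists X => //; move: H; rewrite IH scons_up.
Qed.

End Renaming.

(* [look h e] is the environment whose variables are those of [e] and constants:
   this builds number parameters into the classes [tm] and [dd]. *)
Definition look (M : L2structure) (h : nat -> nat + num M) (e : nat -> num M) (n : nat) :=
  match h n with inl k => e k | inr c => c end.

Definition tm (M : L2structure) (t : (nat -> num M) -> num M) : Prop :=
  exists u h, forall e, t e = eval (look h e) u.

(** A semantic class closed under the logical operations: definability is checked on Rocq
    propositions, and no formula has to be written out. Since set parameters are allowed, over
    arithmetical comprehension the same class contains every arithmetical relation. *)
Definition dd (M : L2structure) (P : (nat -> num M) -> Prop) : Prop :=
  exists A s h, [/\ Delta00 A, forall i, sets M (s i)
    & forall e, P e <-> sat (look h e) s A].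

(** Interleaving two lists of parameters lets two formulas be read over one common list. *)
Definition merge (T : Type) (a b : nat -> T) (n : nat) : T :=
  if odd n then b n./2 else a n./2.

Section Definability.
Variable M : L2structure.
Notation env := (nat -> num M).
Implicit Types (e : env) (P Q : env -> Prop) (t u : env -> num M).

Lemma merge_double T (a b : nat -> T) : merge a b \o double = a.
Proof. by apply/funext => n /=; rewrite /merge odd_double doubleK. Qed.

Lemma merge_doubleS T (a b : nat -> T) : merge a b \o (fun n => n.*2.+1) = b.
Proof. by apply/funext => n /=; rewrite /merge /= odd_double /= uphalf_double. Qed.

Lemma look_comp (h : nat -> nat + num M) f e : look h e \o f = look (h \o f) e.
Proof. by []. Qed.

Lemma dd2 P Q : dd P -> dd Q -> exists A B s h,
  [/\ Delta00 A, Delta00 B, forall i, sets M (s i),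
      forall e, P e <-> sat (look h e) s A & forall e, Q e <-> sat (look h e) s B].
Proof.
move=> [A [s [h [dA ss HA]]]] [B [s' [h' [dB ss' HB]]]].
exists (fren double double A), (fren (fun n => n.*2.+1) (fun n => n.*2.+1) B).
exists (merge s s'), (merge h h'); split.
- exact: Delta00_ren.
- exact: Delta00_ren.
- by move=> i; rewrite /merge; case: ifP.
- by move=> e; rewrite sat_ren !merge_double look_comp merge_double.
- by move=> e; rewrite sat_ren !merge_doubleS look_comp merge_doubleS.
Qed.

Lemma dd_ext P Q : (forall e, P e <-> Q e) -> dd P -> dd Q.
Proof.
move=> PQ [A [s [h [dA ss HA]]]]; exists A, s, h; split=> // e.
by rewrite -PQ.
Qed.

Lemma dd_not P : dd P -> dd (fun e => ~ P e).
Proof.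
move=> [A [s [h [dA ss HA]]]]; exists (Not A), s, h.
by split=> [|//|e /=]; [constructor | rewrite HA].
Qed.

Lemma dd_and P Q : dd P -> dd Q -> dd (fun e => P e /\ Q e).
Proof.
move=> dP dQ; have [A [B [s [h [dA dB ss HA HB]]]]] := dd2 dP dQ.
by exists (And A B), s, h; split=> [|//|e /=]; [constructor | rewrite HA HB].
Qed.

Lemma dd_or P Q : dd P -> dd Q -> dd (fun e => P e \/ Q e).
Proof.
move=> dP dQ; have [A [B [s [h [dA dB ss HA HB]]]]] := dd2 dP dQ.
by exists (Or A B), s, h; split=> [|//|e /=]; [constructor | rewrite HA HB].
Qed.

Lemma dd_imp P Q : dd P -> dd Q -> dd (fun e => P e -> Q e).
Proof.
move=> dP dQ; have [A [B [s [h [dA dB ss HA HB]]]]] := dd2 dP dQ.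
by exists (Imp A B), s, h; split=> [|//|e /=]; [constructor | rewrite HA HB].
Qed.

Lemma dd_iff P Q : dd P -> dd Q -> dd (fun e => P e <-> Q e).
Proof. by move=> dP dQ; apply: dd_and; apply: dd_imp. Qed.

Lemma tm2 t u : tm t -> tm u -> exists a b h,
  (forall e, t e = eval (look h e) a) /\ (forall e, u e = eval (look h e) b).
Proof.
move=> [a [h Ha]] [b [h' Hb]].
exists (tren double a), (tren (fun n => n.*2.+1) b), (merge h h').
split=> e; rewrite eval_ren look_comp ?merge_double ?merge_doubleS.
  exact: Ha.
exact: Hb.
Qed.

Lemma tm_var n : tm (fun e : env => e n).
Proof. by exists (Var 0), (fun _ => inl n). Qed.

Lemma tm_cst c : tm (fun _ : env => c).
Proof. by exists (Var 0), (fun _ => inr c). Qed.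

Lemma tm_add t u : tm t -> tm u -> tm (fun e => t e + u e)%M.
Proof.
move=> dt du; have [a [b [h [Ha Hb]]]] := tm2 dt du.
by exists (Add a b), h => e /=; rewrite Ha Hb.
Qed.

Lemma tm_mul t u : tm t -> tm u -> tm (fun e => t e * u e)%M.
Proof.
move=> dt du; have [a [b [h [Ha Hb]]]] := tm2 dt du.
by exists (Mul a b), h => e /=; rewrite Ha Hb.
Qed.

Lemma dd_eq t u : tm t -> tm u -> dd (fun e => t e = u e).
Proof.
move=> dt du; have [a [b [h [Ha Hb]]]] := tm2 dt du.
have [X sX] := sets_nonempty M.
exists (Eq a b), (fun _ => X), h.
by split=> // [|e /=]; [constructor | rewrite Ha Hb].
Qed.

Lemma dd_lt t u : tm t -> tm u -> dd (fun e => t e < u e)%M.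
Proof.
move=> dt du; have [a [b [h [Ha Hb]]]] := tm2 dt du.
have [X sX] := sets_nonempty M.
exists (Lt a b), (fun _ => X), h.
by split=> // [|e /=]; [constructor | rewrite Ha Hb].
Qed.

Lemma dd_mem (S : set (num M)) t : sets M S -> tm t -> dd (fun e => S (t e)).
Proof.
move=> sS [a [h Ha]]; exists (Mem a 0), (fun _ => S), h.
by split=> // [|e /=]; [constructor | rewrite Ha].
Qed.

Lemma dd_True : dd (fun _ : env => True).
Proof.
apply: (@dd_ext (fun _ : env => zero M = zero M)) => //.
by apply: dd_eq; apply: tm_cst.
Qed.

Lemma dd_cst (P : Prop) : dd (fun _ : env => P).
Proof.
have [p|np] := pselect P; first by apply: (dd_ext _ dd_True).
by apply: (dd_ext _ (dd_not dd_True)) => e; split=> // /(_ I).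
Qed.

Lemma dd_ball t (Q : num M -> env -> Prop) : tm t ->
  dd (fun e => Q (e 0) (fun n => e n.+1)) ->
  dd (fun e => forall x, (x < t e)%M -> Q x e).
Proof.
move=> [a [h Ha]] [A [s [k [dA ss HA]]]].
(* Even positions of the merged list serve [t], odd ones serve [Q], and the binder shifts both by
   one. Variable 0 of [Q] goes to the bound variable, so its entry [zero M] in [k'] is a dummy. *)
pose r n := match k n with inl 0 => 0 | _ => n.*2.+2 end.
pose k' n := match k n with inl 0 => inr (zero M) | inl k.+1 => inl k | inr c => inr c end.
exists (AllBelow (tren double a) (fren r id A)), s, (merge h k'); split=> //.
  by constructor; apply: Delta00_ren.
move=> e /=.
have E x : scons x (look (merge h k') e) \o r = look k (scons x e).
  apply/funext => n; rewrite /= /r [RHS]/look.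
  case E : (k n) => [[|j]|c] //=; rewrite /look /merge /= odd_double /= uphalf_double /k' E //.
have Et x : eval (scons x (look (merge h k') e)) (lift (tren double a)) = t e.
  by rewrite eval_lift eval_ren look_comp merge_double -Ha.
split=> H x; move: (H x); rewrite Et sat_ren E -(HA (scons x e)) //.
Qed.

Lemma dd_bex t (Q : num M -> env -> Prop) : tm t ->
  dd (fun e => Q (e 0) (fun n => e n.+1)) ->
  dd (fun e => exists x, (x < t e)%M /\ Q x e).
Proof.
move=> dt dQ; apply: dd_ext (dd_not (@dd_ball t (fun x e => ~ Q x e) dt (dd_not dQ))) => e.
split=> [H|[x [xt Qx]] /(_ x xt)//].
by apply: contrapT => N; apply: H => x xt Qx; apply: N; exists x.
Qed.

Lemma dd_look (r : nat -> nat + num M) P : dd P -> dd (fun e => P (look r e)).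
Proof.
move=> [A [s [h [dA ss HA]]]].
exists A, s, (fun n => match h n with inl k => r k | inr c => inr c end).
split=> // e; rewrite HA; suff -> : look h (look r e) =
  look (fun n => match h n with inl k => r k | inr c => inr c end) e by [].
by apply/funext => n; rewrite /look; case: (h n).
Qed.

Lemma dd_subst (r : nat -> nat) P : dd P -> dd (fun e => P (e \o r)).
Proof. exact: (@dd_look (fun n => inl (r n))). Qed.

(* The formula sees [x :: n :: e0], where [e0] lists the constants. *)
Lemma dd_formula2 (P Q : num M -> num M -> Prop) :
  dd (fun e => P (e 0) (e 1)) -> dd (fun e => Q (e 0) (e 1)) ->
  exists A B s e0, [/\ Delta00 A, Delta00 B, forall i, sets M (s i),
    forall n x, P n x <-> sat (scons x (scons n e0)) s A &
    forall n x, Q n x <-> sat (scons x (scons n e0)) s B].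
Proof.
move=> dP dQ; have [A [B [s [h [dA dB ss HA HB]]]]] := dd2 dP dQ.
pose r k := match h k with inl 0 => 1 | inl 1 => 0 | _ => k.+2 end.
pose e0 k := match h k with inr c => c | _ => zero M end.
pose z (n x : num M) := scons n (scons x (fun _ => zero M)).
have E n x : scons x (scons n e0) \o r = look h (z n x).
  apply/funext => k; rewrite /= /r /look /z /=.
  by case E : (h k) => [[|[|j]]|c] //=; rewrite /e0 E.
exists (fren r id A), (fren r id B), s, e0; split=> //; try exact: Delta00_ren.
- by move=> n x; rewrite sat_ren E -HA.
- by move=> n x; rewrite sat_ren E -HB.
Qed.

End Definability.

(** * Comprehension and induction for definable relations *)

Record rca_model := RcaModel { rca_structure :> L2structure; rca_axioms : RCA0 rca_structure }.

Section Schemes.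
Variable M : rca_model.

Lemma delta_comprehension (P Q : num M -> num M -> Prop) :
  dd (fun e => P (e 0) (e 1)) -> dd (fun e => Q (e 0) (e 1)) ->
  (forall n, (exists x, P n x) <-> (forall x, Q n x)) ->
  sets M [set n | exists x, P n x].
Proof.
move=> dP dQ PQ; have [A [B [s [e0 [dA dB ss HA HB]]]]] := dd_formula2 dP dQ.
case: (rca_axioms M) => _ _ /(_ (ExNum A) (AllNum B) e0 s) [].
- by exists A.
- by exists B.
- by [].
- move=> n; split=> [[x /= /HA H] y|H]; first by apply/HB/(PQ n).1; exists x.
  by case: ((PQ n).2 _) => [y|x /HA]; [apply/HB/H | exists x].
move=> X sX HX; suff -> : [set n | exists x, P n x] = X by [].
apply/seteqP; split=> n /=; first by case=> x Px; apply/HX; exists x; apply/HA.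
by move=> /HX [x /HA]; exists x.
Qed.

Lemma dd_comprehension (P : num M -> Prop) : dd (fun e => P (e 0)) -> sets M [set n | P n].
Proof.
move=> dP; have := @delta_comprehension (fun n _ => P n) (fun n _ => P n) dP dP.
have E : (forall n, (num M -> P n) <-> P n).
  by move=> n; split=> [|//]; apply; exact: (zero M).
have -> : [set n | P n] = [set n | exists _ : num M, P n].
  by apply/seteqP; split=> n /= => [Pn|[]//]; exists (zero M).
by apply=> n; split=> [[]//|H]; exists (zero M); apply: H; exact: (zero M).
Qed.

Lemma sigma_induction (P : num M -> num M -> Prop) : dd (fun e => P (e 0) (e 1)) ->
  (exists x, P (zero M) x) ->
  (forall n, (exists x, P n x) -> exists x, P (succ n) x) -> forall n, exists x, P n x.
Proof.
move=> dP P0 PS; have [A [_ [s [e0 [dA _ ss HA _]]]]] := dd_formula2 dP dP.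
have E n : (exists x, P n x) <-> sat (scons n e0) s (ExNum A).
  by split=> -[x /HA]; exists x.
move=> n; apply/E; case: (rca_axioms M) => _ H _; apply: H => //; first by exists A.
  exact/E.
by move=> m /E/PS/E.
Qed.

Lemma dd_induction (P : num M -> Prop) : dd (fun e => P (e 0)) ->
  P (zero M) -> (forall n, P n -> P (succ n)) -> forall n, P n.
Proof.
move=> dP P0 PS n.
suff [] : exists _ : num M, P n by [].
apply: (@sigma_induction (fun n _ => P n)) => [//||m [_ /PS Pm]]; by exists (zero M).
Qed.

End Schemes.

(** * Arithmetic *)

Lemma dd_le (M : L2structure) (t u : (nat -> num M) -> num M) :
  tm t -> tm u -> dd (fun e => t e <= u e)%M.
Proof. by move=> dt du; apply: dd_or; [apply: dd_lt | apply: dd_eq]. Qed.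

Ltac tms := cbv beta; lazymatch goal with
  | |- tm (fun e => e ?n) => apply: tm_var
  | |- tm _ => first [assumption | apply: tm_cst | apply: tm_add; tms | apply: tm_mul; tms]
  end.

(** A quantifier is accepted only with its bound written out. This is why sets are rewritten with
    explicit bounds before [dd_comprehension]: the components of a pair are at most its code. *)
Ltac dds := cbv beta; lazymatch goal with
  | |- dd (fun e => ~ _) => apply: dd_not; dds
  | |- dd (fun e => _ /\ _) => apply: dd_and; dds
  | |- dd (fun e => _ \/ _) => apply: dd_or; dds
  | |- dd (fun e => _ <-> _) => apply: dd_iff; dds
  | |- dd (fun e => @eq _ _ _) => apply: dd_eq; tms
  | |- dd (fun e => lt _ _) => apply: dd_lt; tms
  | |- dd (fun e => le _ _) => apply: dd_le; tms
  | |- dd (fun e => exists x, lt x _ /\ _) => apply: dd_bex; [tms | dds]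
  | |- dd (fun e => forall x, lt x _ -> _) => apply: dd_ball; [tms | dds]
  | |- dd (fun e => _ -> _) => apply: dd_imp; dds
  | |- dd _ => try first [assumption | apply: dd_cst | apply: dd_mem; [assumption | tms]]
  end.

Section Arithmetic.
Variable M : rca_model.
Local Open Scope num_scope.
Local Notation "0" := (zero M) : num_scope.
Local Notation "1" := (one M) : num_scope.
Implicit Types x y z m n : num M.

Let ba : basic_axioms M. Proof. by case: (rca_axioms M). Qed.

Lemma num_ind (P : num M -> Prop) : dd (fun e => P (e 0%N)) ->
  P 0 -> (forall n, P n -> P (n + 1)) -> forall n, P n.
Proof. exact: dd_induction. Qed.

Lemma num_addn0 x : x + 0 = x. Proof. exact: (add_0 ba). Qed.
Lemma num_addnS x y : x + (y + 1) = (x + y) + 1. Proof. exact: (add_succ ba). Qed.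
Lemma num_muln0 x : x * 0 = 0. Proof. exact: (mul_0 ba). Qed.
Lemma num_mulnS x y : x * (y + 1) = x * y + x. Proof. exact: (mul_succ ba). Qed.

Lemma num_add0n x : 0 + x = x.
Proof.
move: x; apply: num_ind => [||n IH]; first by dds.
  by rewrite num_addn0.
by rewrite num_addnS IH.
Qed.

Lemma num_addSn x y : (x + 1) + y = (x + y) + 1.
Proof.
move: y; apply: num_ind => [||n IH]; first by dds.
  by rewrite !num_addn0.
by rewrite !num_addnS IH.
Qed.

Lemma num_addC x y : x + y = y + x.
Proof.
move: y; apply: num_ind => [||n IH]; first by dds.
  by rewrite num_addn0 num_add0n.
by rewrite num_addnS num_addSn IH.
Qed.

Lemma num_addA x y z : x + (y + z) = (x + y) + z.
Proof.
move: z; apply: num_ind => [||n IH]; first by dds.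
  by rewrite !num_addn0.
by rewrite !num_addnS IH.
Qed.

Lemma num_mul0n x : 0 * x = 0.
Proof.
move: x; apply: num_ind => [||n IH]; first by dds.
  by rewrite num_muln0.
by rewrite num_mulnS IH num_addn0.
Qed.

Lemma num_mul1n x : 1 * x = x.
Proof.
move: x; apply: num_ind => [||n IH]; first by dds.
  by rewrite num_muln0.
by rewrite num_mulnS IH.
Qed.

Lemma num_mulDl x y z : (x + y) * z = x * z + y * z.
Proof.
move: z; apply: num_ind => [||n IH]; first by dds.
  by rewrite !num_muln0 num_addn0.
rewrite !num_mulnS IH -!num_addA; congr (_ + _).
by rewrite [RHS]num_addC -num_addA; congr (_ + _); rewrite num_addC.
Qed.

Lemma num_mulC x y : x * y = y * x.
Proof.
move: y; apply: num_ind => [||n IH]; first by dds.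
  by rewrite num_muln0 num_mul0n.
by rewrite num_mulnS num_mulDl IH num_mul1n.
Qed.

Lemma num_mulA x y z : x * (y * z) = (x * y) * z.
Proof.
move: z; apply: num_ind => [||n IH]; first by dds.
  by rewrite !num_muln0.
by rewrite !num_mulnS num_mulC num_mulDl num_mulC IH [y * x]num_mulC.
Qed.

Lemma num_semiring : semi_ring_theory 0 1 (@add M) (@mul M) (@eq (num M)).
Proof.
split; [exact: num_add0n|exact: num_addC|exact: num_addA|exact: num_mul1n|exact: num_mul0n
  |exact: num_mulC|exact: num_mulA|exact: num_mulDl].
Qed.

Add Ring num_ring : num_semiring.

Lemma num_succ_neq0 x : x + 1 <> 0. Proof. exact: (succ_neq0 ba). Qed.
Lemma num_succ_inj x y : x + 1 = y + 1 -> x = y. Proof. exact: (succ_inj ba). Qed.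
Lemma num_lt0 x : ~ x < 0. Proof. exact: (not_lt_0 ba). Qed.
Lemma num_ltS x y : x < y + 1 <-> x <= y. Proof. exact: (lt_succ ba). Qed.

Lemma num_case x : x = 0 \/ exists y, x = y + 1.
Proof.
suff [y] : exists y, x = 0 \/ x = y + 1 by case=> H; [left|right; exists y].
move: x; apply: (@sigma_induction _ (fun x y => x = 0 \/ x = y + 1)); first by dds.
  by exists 0; left.
by move=> n _; exists n; right.
Qed.

Lemma addIn z x y : x + z = y + z -> x = y.
Proof.
move: z; apply: num_ind => [||n IH]; first by dds.
  by rewrite !num_addn0.
by rewrite !num_addnS => /num_succ_inj.
Qed.

Lemma addnI z x y : z + x = z + y -> x = y.
Proof. by rewrite ![z + _]num_addC; apply: addIn. Qed.

Lemma add_eq0 x y : x + y = 0 -> x = 0 /\ y = 0.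
Proof.
case: (num_case y) => [->|[z ->]]; first by rewrite num_addn0.
by rewrite num_addnS => /num_succ_neq0.
Qed.

Lemma ltP x y : x < y <-> exists d, y = x + d + 1.
Proof.
split=> [|[d ->]]; last first.
  move: d; apply: num_ind => [||n IH]; first by dds.
    by rewrite num_addn0; apply/num_ltS; right.
  by apply/num_ltS; left; rewrite num_addnS.
(* With the hypothesis moved under the existential the statement is Sigma^0_1 and can be proved by
   induction on [y]. *)
suff : forall y, exists d, x < y -> y = x + d + 1.
  by move=> /(_ y) [d H] /H ->; exists d.
apply: (@sigma_induction _ (fun y d => x < y -> y = x + d + 1)) => [||n [d IH]].
- by dds.
- by exists 0 => /num_lt0.
- case: (pselect (x < n)) => [/IH ->|xn].
    by exists (d + 1) => _; rewrite /succ; ring.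
  by exists 0 => /num_ltS [//|->]; rewrite num_addn0.
Qed.

Lemma leP x y : x <= y <-> exists d, y = x + d.
Proof.
rewrite -num_ltS ltP; split=> -[d]; last by move=> ->; exists d.
by move=> /num_succ_inj ->; exists d.
Qed.

Lemma ltW x y : x < y -> x <= y. Proof. by left. Qed.
Lemma le0x x : 0 <= x. Proof. by apply/leP; exists x; ring. Qed.
Lemma lt_succ x : x < x + 1. Proof. by apply/num_ltS; right. Qed.

Lemma ltxx x : ~ x < x.
Proof.
move=> /ltP [d]; rewrite -num_addA -{1}(num_addn0 x) => /addnI /esym.
exact: num_succ_neq0.
Qed.

Lemma le_trans y x z : x <= y -> y <= z -> x <= z.
Proof. by move=> /leP [d ->] /leP [d' ->]; apply/leP; exists (d + d'); ring. Qed.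

Lemma lt_le_trans y x z : x < y -> y <= z -> x < z.
Proof. by move=> /ltP [d ->] /leP [d' ->]; apply/ltP; exists (d + d'); ring. Qed.

Lemma le_lt_trans y x z : x <= y -> y < z -> x < z.
Proof. by move=> /leP [d ->] /ltP [d' ->]; apply/ltP; exists (d + d'); ring. Qed.

Lemma lt_trans y x z : x < y -> y < z -> x < z.
Proof. by move=> xy /ltW; apply: lt_le_trans. Qed.

Lemma leS x y : x < y <-> x + 1 <= y.
Proof. by rewrite ltP leP; split=> -[d ->]; exists d; ring. Qed.

Lemma le_or_lt x y : x <= y \/ y < x.
Proof.
move: y; apply: num_ind => [||n IH]; first by dds.
  by case: (num_case x) => [->|[y ->]]; [left; right | right; apply/ltP; exists y; ring].
case: IH => [H|]; first by left; apply: le_trans H _; left; apply: lt_succ.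
by move=> /leS [H|->]; [right | left; right].
Qed.

Lemma lt_nle x y : x < y -> ~ y <= x.
Proof. by move=> xy yx; apply: (@ltxx x); apply: lt_le_trans yx. Qed.

Lemma le_nlt x y : x <= y -> ~ y < x.
Proof. by move=> xy yx; apply: (lt_nle yx). Qed.

Lemma nle_lt x y : ~ x <= y -> y < x.
Proof. by case: (le_or_lt x y). Qed.

Lemma lt_neq x y : x < y -> x <> y.
Proof. by move=> xy E; move: xy; rewrite E => /ltxx. Qed.

Lemma trichotomy x y : [\/ x < y, x = y | y < x].
Proof. by case: (le_or_lt x y) => [[]|]; [constructor 1 | constructor 2 | constructor 3]. Qed.

Lemma le_addr x y : x <= x + y. Proof. by apply/leP; exists y. Qed.
Lemma le_addl x y : x <= y + x. Proof. by apply/leP; exists y; ring. Qed.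

Lemma le_add x y z t : x <= y -> z <= t -> x + z <= y + t.
Proof. by move=> /leP [d ->] /leP [d' ->]; apply/leP; exists (d + d'); ring. Qed.

Lemma le_mul x y z t : x <= y -> z <= t -> x * z <= y * t.
Proof.
move=> /leP [d ->] /leP [d' ->]; apply/leP; exists (x * d' + d * z + d * d'); ring.
Qed.

Lemma le_sqr x : x <= x * x.
Proof.
case: (num_case x) => [->|[y ->]]; first by apply: le0x.
by apply/leP; exists (y * y + y); ring.
Qed.

Lemma pair_gel x y : x <= pair x y.
Proof. exact: le_addl. Qed.

Lemma pair_ger x y : y <= pair x y.
Proof.
apply: le_trans (le_addr _ _); apply: le_trans (le_sqr _); exact: le_addl.
Qed.

(** With s = x + y, the code s^2 + x lies below (s + 1)^2. So the code determines s, then x, then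
    y. *)
Lemma pair_inj x y x' y' : pair x y = pair x' y' -> x = x' /\ y = y'.
Proof.
have H (a b c d : num M) : a + b < c + d -> pair a b <> pair c d.
  move=> /ltP [k E]; apply: lt_neq; rewrite /pair E; apply/ltP.
  by exists ((a + b) * (k + k + 1) + b + k + k + k * k + c); ring.
move=> E; case: (trichotomy (x + y) (x' + y')) => [/H //|S|/H N]; last by case: N.
move: E; rewrite /pair S => /addnI E; split=> //.
by move: S; rewrite E => /addnI.
Qed.

End Arithmetic.

(** * Neighborhood systems and arithmetical comprehension *)

Section DefinabilityRCA.
Variable M : rca_model.
Local Open Scope num_scope.
Local Notation "0" := (zero M) : num_scope.
Local Notation "1" := (one M) : num_scope.

Lemma dd_args1 (P : num M -> Prop) : dd (fun e => P (e 0%N)) ->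
  forall i, dd (fun e => P (e i)).
Proof. by move=> dP i; apply: dd_ext (dd_subst (fun _ => i) dP). Qed.

Lemma dd_args2 (P : num M -> num M -> Prop) : dd (fun e => P (e 0%N) (e 1%N)) ->
  forall i j, dd (fun e => P (e i) (e j)).
Proof.
by move=> dP i j; apply: dd_ext (dd_subst (fun n => if n is 0%N then i else j) dP).
Qed.

Lemma dd_args3 (P : num M -> num M -> num M -> Prop) :
  dd (fun e => P (e 0%N) (e 1%N) (e 2%N)) -> forall i j k, dd (fun e => P (e i) (e j) (e k)).
Proof.
move=> dP i j k.
by apply: dd_ext (dd_subst (fun n => match n with 0%N => i | 1%N => j | _ => k end) dP).
Qed.

Lemma dd_section (P : num M -> num M -> Prop) : dd (fun e => P (e 0%N) (e 1%N)) ->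
  forall n, dd (fun e => P n (e 0%N)).
Proof.
by move=> dP n; apply: dd_ext (dd_look (fun k => if k is 0%N then inr n else inl 0%N) dP).
Qed.

(** That no number below [m] satisfies [P] is again a bounded statement, so induction on [m]
    applies. *)
Lemma least (P : num M -> Prop) n : dd (fun e => P (e 0%N)) -> P n ->
  exists2 m, P m & forall k, k < m -> ~ P k.
Proof.
move=> dP Pn; apply: contrapT => H.
suff /(_ (n + 1) n) : forall m k, k < m -> ~ P k by apply=> //; apply: lt_succ.
apply: num_ind => [||m IH k /num_ltS []]; try exact: IH; last 1 first.
- by move=> -> Pm; apply: H; exists m.
- by dds; apply: dd_args1.
- by move=> k /num_lt0.
Qed.

End DefinabilityRCA.

(** As [finite] means bounded, a finite subcover can be enlarged to all members of [I] below some
    [b], a set by bounded comprehension. *)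
Lemma compact_subsetP (M : rca_model) (U Y : set (num M)) :
  compact_subset U Y <-> forall I, sets M I ->
    (forall y, Y y -> exists2 i, I i & col U i y) ->
    exists b, forall y, Y y -> exists i, [/\ (i < b)%M, I i & col U i y].
Proof.
split=> [cY I sI cov|H I sI E].
  case: (cY I sI) => [|a [_ [b ab] aI E]].
    apply/seteqP; split=> [y Yy|y [i _ []//]].
    by case: (cov y Yy) => i Ii Uy; exists i.
  exists b => y; rewrite E => -[i ai [Uy _]].
  by exists i; split=> //; [apply: ab | apply: aI].
case: (H I sI) => [y Yy|b Hb]; first by move: (Yy); rewrite E => -[i Ii [Ui _]]; exists i.
exists [set i | (i < b)%M /\ I i]; split.
- apply: dd_comprehension; dds.
- by exists b => n [].
- by move=> n [].
- apply/seteqP; split=> [y Yy|y [i _ []//]].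
  by case: (Hb y Yy) => i [ib Ii Uy]; exists i.
Qed.

Lemma compact_subset1 (M : rca_model) (U : set (num M)) x : compact_subset U [set x].
Proof.
apply/compact_subsetP => I sI /(_ x erefl) [i Ii Ui].
by exists (i + one M)%M => y ->; exists i; split=> //; apply: lt_succ.
Qed.

(* [Nb x m] is the [m]-th basic neighborhood of [x]; its index is [pair x m]. *)
Record nbhd_system (M : rca_model) (X : set (num M)) (Nb : num M -> num M -> num M -> Prop) := {
  nb_sets : sets M X;
  nb_dd : dd (fun e => Nb (e 0) (e 1) (e 2));
  nb_dom : forall x m y, Nb x m y -> X x /\ X y;
  nb_refl : forall x m, X x -> Nb x m x;
  nb_anti : forall x m m' y, (m <= m')%M -> Nb x m' y -> Nb x m y;
  nb_open : forall x m y m' z, Nb x m y -> y <> x -> Nb y m' z -> Nb x m z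
}.

Section NbhdSpace.
Variables (M : rca_model) (X : set (num M)) (Nb : num M -> num M -> num M -> Prop).
Hypothesis nbs : nbhd_system X Nb.
Local Open Scope num_scope.
Local Notation "0" := (zero M) : num_scope.
Local Notation "1" := (one M) : num_scope.

Definition nbU : set (num M) :=
  [set c | exists y x m, c = pair y (pair x m) /\ Nb x m y].

(** The number [m + m'] works without knowing which centers equal [x]: if [y] is [x], neighborhoods
    decrease with their number; otherwise every neighborhood of [x] lies in [Nb y m] by
    [nb_open]. *)
Definition nbk : set (num M) :=
  [set c | exists x y m y' m',
     c = pair (triple x (pair y m) (pair y' m')) (pair x (m + m')) /\ X x].

Lemma col_nbU i y : col nbU i y <-> exists x m, i = pair x m /\ Nb x m y.
Proof.
split=> [[y' [x [m [/pair_inj [-> ->]]]]]|[x [m [-> H]]]]; first by exists x, m.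
by exists y, x, m.
Qed.

Lemma col_nbU_pair x m y : col nbU (pair x m) y <-> Nb x m y.
Proof.
by rewrite col_nbU; split=> [[x' [m' [/pair_inj [-> ->]]]] //|H]; exists x, m.
Qed.

Lemma sets_nbU : sets M nbU.
Proof.
have -> : nbU = [set c | exists y, y < c + 1 /\ exists x, x < c + 1 /\
    exists m, m < c + 1 /\ (c = pair y (pair x m) /\ Nb x m y)].
  apply/seteqP; split=> c; last first.
    by move=> [y [_ [x [_ [m [_ H]]]]]]; exists y, x, m.
  move=> [y [x [m [-> H]]]].
  have h1 := pair_gel y (pair x m); have h2 := pair_ger y (pair x m).
  exists y; split; first by apply/num_ltS.
  exists x; split; first by apply/num_ltS; apply: le_trans h2; apply: pair_gel.
  exists m; split; first by apply/num_ltS; apply: le_trans h2; apply: pair_ger.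
  by [].
apply: dd_comprehension; dds.
exact: (dd_args3 (nb_dd nbs)).
Qed.

Lemma sets_nbk : sets M nbk.
Proof.
have sX := nb_sets nbs.
have -> : nbk = [set c | exists x, x < c + 1 /\ exists y, y < c + 1 /\
    exists m, m < c + 1 /\ exists y', y' < c + 1 /\ exists m', m' < c + 1 /\
     (c = pair (triple x (pair y m) (pair y' m')) (pair x (m + m')) /\ X x)].
  apply/seteqP; split=> c; last first.
    by move=> [x [_ [y [_ [m [_ [y' [_ [m' [_ H]]]]]]]]]]; exists x, y, m, y', m'.
  move=> [x [y [m [y' [m' [-> Xx]]]]]].
  have h := pair_gel (triple x (pair y m) (pair y' m')) (pair x (m + m')).
  have h1 := le_trans (pair_gel (pair x (pair y m)) (pair y' m')) h.
  have h2 := le_trans (pair_ger (pair x (pair y m)) (pair y' m')) h.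
  have h3 := le_trans (pair_ger x (pair y m)) h1.
  exists x; split; first by apply/num_ltS; apply: le_trans h1; apply: pair_gel.
  exists y; split; first by apply/num_ltS; apply: le_trans h3; apply: pair_gel.
  exists m; split; first by apply/num_ltS; apply: le_trans h3; apply: pair_ger.
  exists y'; split; first by apply/num_ltS; apply: le_trans h2; apply: pair_gel.
  exists m'; split; first by apply/num_ltS; apply: le_trans h2; apply: pair_ger.
  by [].
apply: dd_comprehension; dds.
Qed.

Lemma nbhd_CSC : CSC_space X nbU nbk.
Proof.
split.
- exact: nb_sets nbs.
- exact: sets_nbU.
- exact: sets_nbk.
- by move=> i y /col_nbU [x [m [_ /(nb_dom nbs) []]]].
- by move=> x Xx; exists (pair x 0); apply/col_nbU_pair; apply: (nb_refl nbs).
- split=> [p [x [y [m [y' [m' [-> Xx]]]]]]|a b c].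
    exists (triple x (pair y m) (pair y' m')), (pair x (m + m')); split=> //.
    by exists x, (pair y m), (pair y' m').
  move=> [x [y [m [y' [m' [/pair_inj [-> ->] _]]]]]].
  move=> [? [? [? [? [? [/pair_inj [E ->] _]]]]]]; move: E.
  by move=> /pair_inj [/pair_inj [<- /pair_inj [_ <-]] /pair_inj [_ <-]].
- move=> x i j [/col_nbU [y [m [-> H]]] /col_nbU [y' [m' [-> H']]]].
  have [_ Xx] := nb_dom nbs H.
  exists (pair x (m + m')); split; first by exists x, y, m, y', m'.
    by apply/col_nbU_pair; apply: (nb_refl nbs).
  have K : forall y m m'', Nb y m x -> m <= m'' -> forall z, Nb x m'' z -> Nb y m z.
    move=> {H H'} {}y {}m m'' H le z Hz; case: (pselect (x = y)) => [E|N].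
      by move: Hz; rewrite E; apply: (nb_anti nbs).
    exact: (nb_open nbs H N Hz).
  move=> z /col_nbU_pair Hz; split; apply/col_nbU_pair.
    by apply: K H _ _ Hz; apply: le_addr.
  by apply: K H' _ _ Hz; apply: le_addl.
Qed.

(** The chosen index may belong to a neighborhood [Nb y m] of another center [y]. Still [Nb x m],
    with the same [m], lies in the chosen compact set: it is [Nb y m] if [y] is [x], and is
    contained in it by [nb_open] otherwise. So [m] can be used as a bound attached to [x]. *)
Lemma nbhd_choice : T2_locally_compact_have_choice M ->
  (forall x y, X x -> X y -> x <> y -> exists m m', forall z, Nb x m z -> Nb y m' z -> False) ->
  (forall x, X x -> exists m K, [/\ sets M K, K `<=` X, compact_subset nbU K
     & Nb x m `<=` K]) ->
  exists F : set (num M), [/\ sets M F,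
    forall x, X x -> exists i, F (pair x i),
    forall x i j, F (pair x i) -> F (pair x j) -> i = j &
    forall x i, X x -> F (pair x i) -> exists y m, [/\ i = pair y m, Nb y m x
       & exists2 K, K `<=` X /\ compact_subset nbU K & Nb x m `<=` K]].
Proof.
move=> ch t2 lc.
case: (ch X nbU nbk nbhd_CSC) => [x y Xx Xy xy|x Xx|K [F [sK sF [[Fd Ff] Ft] H]]].
- case: (t2 x y Xx Xy xy) => m [m' D].
  exists (pair x m), (pair y m'); split; try (apply/col_nbU_pair; exact: (nb_refl nbs)).
  by apply/seteqP; split=> // z [/col_nbU_pair h /col_nbU_pair]; apply: D h.
- case: (lc x Xx) => m [K [sK KX cK NK]]; exists (pair x m), K; split=> //.
    by apply/col_nbU_pair; apply: (nb_refl nbs).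
  by move=> z /col_nbU_pair; apply: NK.
exists F; split=> // x i Xx Fi; case: (H x i Xx Fi) => Ux UK KX cK.
case/col_nbU: Ux => y [m [E Ny]]; exists y, m; split=> //.
exists (col K x) => // z Hz; apply: UK; rewrite E; apply/col_nbU_pair.
case: (pselect (x = y)) => [<-//|N]; exact: (nb_open nbs Ny N Hz).
Qed.

End NbhdSpace.

(** * Sigma^0_1 comprehension from the choice principle *)

Section SigmaComprehension.
Variable M : rca_model.
Hypothesis choice : T2_locally_compact_have_choice M.
Variable theta : num M -> num M -> Prop.
Hypothesis dd_theta : dd (fun e => theta (e 0) (e 1)).
Local Open Scope num_scope.
Local Notation "0" := (zero M) : num_scope.
Local Notation "1" := (one M) : num_scope.

Definition least_wit n s := theta n s /\ forall s', s' < s -> ~ theta n s'.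

Lemma dd_least_wit i j : dd (fun e => least_wit (e i) (e j)).
Proof. by rewrite /least_wit; dds; apply: dd_args2. Qed.

Lemma least_wit_inj n s s' : least_wit n s -> least_wit n s' -> s = s'.
Proof. by move=> [H K] [H' K']; case: (trichotomy s s') => // [/K'|/K]. Qed.

(* [pair n 0] is isolated unless [n] has a witness, in which case it is the
   limit of the points [pair n w] with [w] beyond the least witness. *)
Definition wpt : set (num M) :=
  [set x | exists n w, x = pair n w /\ (w = 0 \/ exists s, s < w /\ least_wit n s)].

(** Since the least witness [s] is unique, the neighborhood of [pair n 0] jumps at [m = s + 1] from
    an infinite row to the single point. *)
Definition wnb (x m y : num M) : Prop :=
  [/\ wpt x, wpt y & y = x \/ exists n w s,
    [/\ x = pair n 0, y = pair n w, m <= s, s < w & least_wit n s]].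

Lemma sets_wpt : sets M wpt.
Proof.
have -> : wpt = [set x | exists n, n < x + 1 /\ exists w, w < x + 1 /\
    (x = pair n w /\ (w = 0 \/ exists s, s < w /\ least_wit n s))].
  apply/seteqP; split=> x [n]; last by move=> [_ [w [_ H]]]; exists n, w.
  move=> [w [-> H]]; exists n; split; first by apply/num_ltS/pair_gel.
  by exists w; split=> //; apply/num_ltS/pair_ger.
apply: dd_comprehension; dds; exact: dd_least_wit.
Qed.

Lemma wnb_system : nbhd_system wpt wnb.
Proof.
have sw := sets_wpt; split=> //.
- apply: (@dd_ext _ (fun e => wpt (e 0%N) /\ wpt (e 2%N) /\ (e 2%N = e 0%N \/
    exists n, n < e 0%N + 1 /\ exists w, w < e 2%N + 1 /\ exists s, s < w /\
     (e 0%N = pair n 0 /\ e 2%N = pair n w /\ e 1%N <= s /\ least_wit n s)))).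
    move=> e; rewrite /wnb; split.
      move=> [h1 [h2 h]]; split=> //; case: h; first by left.
      move=> [n [_ [w [_ [s [sw' [e0 [e2 [ms ls]]]]]]]]]; right.
      by exists n, w, s.
    move=> [h1 h2 h]; split=> //; split=> //; case: h; first by left.
    move=> [n [w [s [e0 e2 ms sw' ls]]]]; right.
    exists n; split; first by rewrite e0; apply/num_ltS/pair_gel.
    exists w; split; first by rewrite e2; apply/num_ltS/pair_ger.
    by exists s.
  by dds; exact: dd_least_wit.
- by move=> x m y [].
- by move=> x m Xx; split=> //; left.
- move=> x m m' y le [Xx Xy [yx|[n [w [s [Ex Ey ms sw' ls]]]]]]; split=> //; first by left.
  by right; exists n, w, s; split=> //; apply: le_trans ms.
- move=> x m y m' z [Xx Xy [//|[n [w [s [Ex Ey ms sw' ls]]]]]] N [_ Xz].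
  rewrite Ey; case=> [->|[n' [? [? [/pair_inj [_ E]]]]]]; last by move: sw'; rewrite E => /num_lt0.
  by split; [|rewrite -Ey|right; exists n, w, s].
Qed.

Lemma wnb_pos n w m z : w <> 0 -> wnb (pair n w) m z -> z = pair n w.
Proof. by move=> w0 [_ _ [//|[n' [? [? [/pair_inj [_ /w0]]]]]]]. Qed.

Lemma wnb0 n m z : wnb (pair n 0) m z -> exists w, z = pair n w.
Proof.
move=> [_ _ [->|[n' [w [? [/pair_inj [<- _] -> _ _ _]]]]]]; first by exists 0.
by exists w.
Qed.

Lemma wpt0 n : wpt (pair n 0).
Proof. by exists n, 0; split=> //; left. Qed.

Lemma sigma_comprehension : sets M [set n | exists s, theta n s].
Proof.
have sep x y : wpt x -> wpt y -> x <> y -> exists m m', forall z,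
    wnb x m z -> wnb y m' z -> False.
  move=> Xx Xy; case: (Xx) (Xy) => [n [w [-> _]]] [n' [w' [-> _]]] N.
  case: (pselect (w = 0)) => [w0|w0]; case: (pselect (w' = 0)) => [w0'|w0'].
  - exists 0, 0 => z; rewrite w0 w0' => /wnb0 [v ->] /wnb0 [v' /pair_inj [E _]].
    by apply: N; rewrite w0 w0' E.
  (* A neighborhood of [pair n 0] with number [w'] misses [pair n w'], which would require
     [w' <= s < w']. *)
  - exists w', 0 => z Hz /(wnb_pos w0') E; move: Hz; rewrite E => -[_ _ [/esym //|]].
    move=> [? [? [s [_ /pair_inj [_ <-] ms sw _]]]]; exact: (lt_nle sw ms).
  - exists 0, w => z /(wnb_pos w0) ->; move=> -[_ _ [//|]].
    move=> [? [? [s [_ /pair_inj [_ <-] ms sw _]]]]; exact: (lt_nle sw ms).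
  - by exists 0, 0 => z /(wnb_pos w0) -> /(wnb_pos w0').
(* Singletons serve as compact neighborhoods. What cannot be done uniformly in the point is to find
   the number [m] for which the neighborhood is a singleton. *)
have lc x : wpt x -> exists m K,
    [/\ sets M K, K `<=` wpt, compact_subset (nbU wnb) K & wnb x m `<=` K].
  move=> Xx; suff [m Hm] : exists m, forall z, wnb x m z -> z = x.
    exists m, [set x]; split=> //.
    - by apply: dd_comprehension; dds.
    - by move=> _ ->.
    - exact: compact_subset1.
  case: (pselect (exists n s, x = pair n 0 /\ least_wit n s)).
    move=> [n [s [-> ls]]]; exists (s + 1) => z [_ _ [//|]].
    move=> [? [? [s' [/pair_inj [<- _] _ /leS ss' _ ls']]]].
    by case: (@ltxx _ s); rewrite {2}(least_wit_inj ls ls').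
  move=> N; exists 0 => z [_ _ [//|[n [w [s [E _ _ _ ls]]]]]].
  by case: N; exists n, s.
case: (nbhd_choice wnb_system choice sep lc) => F [sF Ft Ff FK].
have bound n s i : least_wit n s -> F (pair (pair n 0) i) ->
    exists y m, i = pair y m /\ s < m.
  move=> ls Fi; case: (FK _ _ (wpt0 n) Fi) => y [m [-> Ny [K [KX /compact_subsetP cK] NK]]].
  exists y, m; split=> //; apply: nle_lt => ms.
  (* If [m <= s], the compact set contains the whole row of [n]. This cover uses for [pair n 0] only
     numbers above [s], so that each of its members contains at most one point of the row. *)
  pose I := [set i | exists y, y < i + 1 /\ exists m', m' < i + 1 /\
    (i = pair y m' /\ (y = pair n 0 -> s < m'))].
  have sI : sets M I by apply: dd_comprehension; dds.
  have II z m' : (z = pair n 0 -> s < m') -> I (pair z m').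
    move=> H; exists z; split; first by apply/num_ltS/pair_gel.
    by exists m'; split=> //; apply/num_ltS/pair_ger.
  case: (cK I sI) => [z Kz|b Hb].
    case: (pselect (z = pair n 0)) => [E|N].
      exists (pair z (s + 1)); first by apply: II => _; apply: lt_succ.
      by apply/col_nbU_pair/(nb_refl wnb_system)/KX.
    exists (pair z 0); first exact: II.
    by apply/col_nbU_pair/(nb_refl wnb_system)/KX.
  (* Only a neighborhood centered at [pair n w] itself can cover this point, and its index is at
     least [w], hence not below [b]. *)
  pose w := s + 1 + b.
  have sw : s < w by apply: lt_le_trans (le_addr _ _); apply: lt_succ.
  have Kw : K (pair n w).
    apply: NK; split; [exact: wpt0 | |by right; exists n, w, s].
    by exists n, w; split=> //; right; exists s.
  case: (Hb _ Kw) => i' [ib [z [_ [m' [_ [E zs]]]]] /col_nbU [z' [m'' [E' [_ _ H]]]]].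
  move: E'; rewrite E => /pair_inj [Ez Em].
  case: H => [Ew|[n' [w' [s' [Ez' /pair_inj [En Ew] ms' sw' ls']]]]].
    apply: (@lt_nle _ _ _ ib); rewrite E Ez -Ew.
    apply: le_trans (pair_gel _ _); apply: le_trans (pair_ger _ _); exact: le_addl.
  rewrite -En in ls' Ez'; rewrite -Em (least_wit_inj ls' ls) in ms'.
  by apply: (lt_nle (zs _) ms'); rewrite Ez.
(* The witness is bounded by a value of the total function [F], so quantifying that value
   existentially or universally gives a Sigma and a Pi form of the same set. *)
pose P n i := F (pair (pair n 0) i) /\ exists m, m < i + 1 /\ exists s, s < m /\
   (theta n s /\ exists y, y < i + 1 /\ i = pair y m).
pose Q n i := F (pair (pair n 0) i) -> exists m, m < i + 1 /\ exists s, s < m /\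
   (theta n s /\ exists y, y < i + 1 /\ i = pair y m).
have dP : dd (fun e => P (e 0%N) (e 1%N)).
  by rewrite /P; dds; apply: dd_args2.
have dQ : dd (fun e => Q (e 0%N) (e 1%N)).
  by rewrite /Q; dds; apply: dd_args2.
have E n : (exists s, theta n s) <-> exists i, P n i.
  split=> [[s0 T0]|[i [_ [m [_ [s [_ [T _]]]]]]]]; last by exists s.
  have [s Ts ls] := @least _ (theta n) s0 (dd_section dd_theta n) T0.
  case: (Ft _ (wpt0 n)) => i Fi; case: (bound n s i _ Fi) => // y [m [Ei sm]].
  exists i; split=> //; exists m; split; first by rewrite Ei; apply/num_ltS/pair_ger.
  exists s; split=> //; split=> //; exists y; split=> //.
  by rewrite Ei; apply/num_ltS/pair_gel.
have -> : [set n | exists s, theta n s] = [set n | exists i, P n i].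
  by apply/seteqP; split=> n /E.
apply: (delta_comprehension dP dQ) => n; split=> [[i [Fi H]] j Fj|H].
  by rewrite (Ff _ _ _ Fj Fi).
by case: (Ft _ (wpt0 n)) => i Fi; exists i; split=> //; apply: H.
Qed.

End SigmaComprehension.

(** * Closure of the definable relations under number quantifiers *)

Section FiniteSupport.
Variable M : L2structure.
Implicit Types (e : nat -> num M) (s : nat -> set (num M)).

Definition agree (T : Type) (N : nat) (e e' : nat -> T) := forall k, k < N -> e k = e' k.

Lemma agreeW T (N N' : nat) (e e' : nat -> T) : N <= N' -> agree N' e e' -> agree N e e'.
Proof. by move=> le H k kN; apply: H; apply: leq_trans le. Qed.

Lemma eval_support t : exists N, forall e e', agree N e e' -> eval e t = eval e' t.
Proof.
elim: t => [n|||t [N HN] u [N' HN']|t [N HN] u [N' HN']].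
- by exists n.+1 => e e'; apply.
- by exists 0.
- by exists 0.
- exists (maxn N N') => e e' H /=; rewrite (HN e e') ?(HN' e e') //; apply: agreeW H.
    exact: leq_maxr.
  exact: leq_maxl.
- exists (maxn N N') => e e' H /=; rewrite (HN e e') ?(HN' e e') //; apply: agreeW H.
    exact: leq_maxr.
  exact: leq_maxl.
Qed.

Lemma agree_scons N e e' (x : num M) : agree N e e' -> agree N (scons x e) (scons x e').
Proof. by move=> H [|k] // kN; apply: H; apply: ltnW. Qed.

Lemma sat_support A : exists N, forall e e' s, agree N e e' -> sat e s A <-> sat e' s A.
Proof.
have bin (P : (nat -> num M) -> (nat -> set (num M)) -> Prop) Q (op : Prop -> Prop -> Prop) :
  (exists N, forall e e' s, agree N e e' -> P e s <-> P e' s) ->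
  (exists N, forall e e' s, agree N e e' -> Q e s <-> Q e' s) ->
  exists N, forall e e' s, agree N e e' -> op (P e s) (Q e s) <-> op (P e' s) (Q e' s).
  move=> [N HN] [N' HN']; exists (maxn N N') => e e' s H.
  have /propext -> : P e s <-> P e' s by apply/HN/(agreeW _ H)/leq_maxl.
  by have /propext -> : Q e s <-> Q e' s by apply/HN'/(agreeW _ H)/leq_maxr.
elim: A => /=.
- move=> t u; have [N HN] := eval_support t; have [N' HN'] := eval_support u.
  exists (maxn N N') => e e' _ H; rewrite (HN e e') ?(HN' e e') //; apply: agreeW H.
    exact: leq_maxr.
  exact: leq_maxl.
- move=> t u; have [N HN] := eval_support t; have [N' HN'] := eval_support u.
  exists (maxn N N') => e e' _ H; rewrite (HN e e') ?(HN' e e') //; apply: agreeW H.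
    exact: leq_maxr.
  exact: leq_maxl.
- by move=> t n; have [N HN] := eval_support t; exists N => e e' s /HN ->.
- by move=> A [N HN]; exists N => e e' s /HN ->.
- by move=> A HA B HB; apply: bin.
- by move=> A HA B HB; apply: bin.
- by move=> A HA B HB; apply: (bin _ _ (fun P Q => P -> Q)).
- move=> A [N HN]; exists N => e e' s H.
  by split=> K x; move: (K x); rewrite (HN _ _ s (agree_scons x H)).
- move=> A [N HN]; exists N => e e' s H.
  by split=> -[x K]; exists x; move: K; rewrite (HN _ _ s (agree_scons x H)).
- move=> A [N HN]; exists N => e e' s H.
  by split=> K X sX; move: (K X sX); rewrite (HN e e' _ H).
- move=> A [N HN]; exists N => e e' s H.
  by split=> -[X sX K]; exists X => //; move: K; rewrite (HN e e' _ H).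
Qed.

(** Needed because comprehension yields sets of single numbers: only finitely many variables can be
    packed into one. *)
Lemma dd_support (P : (nat -> num M) -> Prop) : dd P ->
  exists N, forall e e', agree N e e' -> P e <-> P e'.
Proof.
move=> [A [s [h [_ _ HA]]]]; have [N HN] := sat_support A.
suff [N' HN'] : exists N', forall e e', agree N' e e' -> agree N (look h e) (look h e').
  by exists N' => e e' /HN' /HN H; rewrite !HA.
elim: N {HN} => [|N [N' IH]]; first by exists 0.
case E : (h N) => [k|c].
  exists (maxn N' k.+1) => e e' H j; rewrite ltnS leq_eqVlt => /orP [/eqP ->|].
    by rewrite /look E; apply: H; rewrite leq_max ltnSn orbT.
  by apply: IH; apply: agreeW H; apply: leq_maxl.
exists N' => e e' H j; rewrite ltnS leq_eqVlt => /orP [/eqP ->|].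
  by rewrite /look E.
exact: IH.
Qed.

End FiniteSupport.

Record aca_model := AcaModel {
  aca_rca :> rca_model;
  aca_sigma : forall theta : num aca_rca -> num aca_rca -> Prop,
    dd (fun e => theta (e 0) (e 1)) -> sets aca_rca [set n | exists s, theta n s] }.

Section ArithmeticalDefinability.
Variable M : aca_model.
Local Open Scope num_scope.
Local Notation "0" := (zero M) : num_scope.
Local Notation "1" := (one M) : num_scope.
Notation env := (nat -> num M).

(* [unpack] replaces the leading variables [a, b] by their pair: [N] iterations
   pack [N.+1] variables into one. *)
Definition unpack (P : env -> Prop) (e : env) : Prop :=
  exists a, a < e 0%N + 1 /\ exists b, b < e 0%N + 1 /\
    (e 0%N = pair a b /\ P (scons a (scons b (fun n => e n.+1)))).

Fixpoint pack (N : nat) (e : env) : num M :=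
  if N is N'.+1 then pair (pack N' e) (e N) else e 0%N.

Lemma dd_unpack P N : dd P -> dd (iter N unpack P).
Proof.
move=> dP; elim: N => [|N IH] //=; rewrite /unpack; dds.
apply: dd_ext (dd_subst (fun n => match n with 0%N => 1%N | 1%N => 0%N | n.+2 => n.+3 end) IH).
move=> e; suff -> : e \o (fun n => match n with 0%N => 1%N | 1%N => 0%N | n.+2 => n.+3 end) =
  scons (e 1%N) (scons (e 0%N) (fun n => e n.+3)) by [].
by apply/funext => -[|[|n]].
Qed.

Lemma unpack_pack P N e :
  iter N unpack P (scons (pack N e) (fun k => e (N + k).+1%N)) <-> P e.
Proof.
elim: N e => [|N IH] e /=.
  suff -> : scons (e 0%N) (fun k => e k.+1) = e by [].
  by apply/funext => -[].
rewrite -IH /unpack /=.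
have E : scons (e N.+1) (fun n => e (N + n).+2%N) = fun k => e (N + k).+1%N.
  by apply/funext => -[|k] /=; rewrite ?addn0 ?addnS.
rewrite -E; split=> [[a [_ [b [_ [/pair_inj [-> ->]]]]]] //|H].
exists (pack N e); split; first by apply/num_ltS/pair_gel.
by exists (e N.+1); split; first by apply/num_ltS/pair_ger.
Qed.

Lemma tm_pack N : tm (fun e : env => pack N e).
Proof. by elim: N => [|N IH] /=; rewrite /pair; tms. Qed.

Lemma pack_agree N (e e' : env) : agree N.+1 e e' -> pack N e = pack N e'.
Proof.
elim: N => [|N IH] H /=; first exact: H.
by rewrite IH ?H //; apply: agreeW H.
Qed.

(** The codes of the tuples that have a witness form a set by Sigma^0_1 comprehension. The
    quantified statement becomes membership of a code in this set parameter, hence is bounded again,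
    and quantifiers can be iterated. *)
Lemma dd_ex (Q : num M -> env -> Prop) :
  dd (fun e => Q (e 0%N) (fun n => e n.+1)) -> dd (fun e => exists x, Q x e).
Proof.
move=> dQ; have [N HN] := dd_support dQ.
(* The quantified variable is placed after the variables that get packed, so that packing leaves it
   free. *)
pose P' e := Q (e N.+1) e.
have dP' : dd P' by apply: dd_ext (dd_subst (fun n => if n is n'.+1 then n' else N.+1) dQ).
pose S := [set c | exists x, iter N unpack P' (scons c (fun _ => x))].
have sS : sets M S.
  apply: aca_sigma; apply: dd_ext (dd_subst (fun n => if n is _.+1 then 1%N else 0%N)
    (dd_unpack N dP')) => e.
  suff -> : e \o (fun n => if n is _.+1 then 1%N else 0%N) = scons (e 0%N) (fun _ => e 1%N) by [].
  by apply/funext => -[].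
apply: dd_ext (dd_mem sS (tm_pack N)) => e; rewrite /S /=.
suff H x : iter N unpack P' (scons (pack N e) (fun _ => x)) <-> Q x e.
  by split=> -[x /H]; exists x.
pose e' k := if (k <= N)%N then e k else x.
have -> : pack N e = pack N e' by apply: pack_agree => k kN; rewrite /e' -ltnS kN.
have -> : (fun _ => x) = (fun k => e' (N + k).+1%N).
  by apply/funext => k; rewrite /e' ltnNge leq_addr.
rewrite unpack_pack /P' /e' ltnn.
apply: (HN (scons x e') (scons x e)) => -[|k] kN //=.
by rewrite /e' ltnW // ltnW.
Qed.

Lemma dd_all (Q : num M -> env -> Prop) :
  dd (fun e => Q (e 0%N) (fun n => e n.+1)) -> dd (fun e => forall x, Q x e).
Proof.
move=> dQ; apply: dd_ext (dd_not (@dd_ex (fun x e => ~ Q x e) (dd_not dQ))) => e.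
split=> [H x|H [x] //]; by apply: contrapT => N; apply: H; exists x.
Qed.

(** Variable 0 stands for the value. A Rocq function [F] with [df (fun e => F (e 0))] plays the part
    of a function of the model: its graph is a set of [M]. *)
Definition df (t : env -> num M) : Prop := dd (fun e => e 0%N = t (fun n => e n.+1)).

Lemma df_tm t : tm t -> df t.
Proof.
move=> [u [h H]]; apply: dd_eq; first exact: tm_var.
exists u, (fun n => match h n with inl k => inl k.+1 | inr c => inr c end) => e.
rewrite H; congr eval; apply/funext => n; rewrite /look; by case: (h n).
Qed.

Lemma dd_at (Q : num M -> env -> Prop) t : df t ->
  dd (fun e => Q (e 0%N) (fun n => e n.+1)) -> dd (fun e => Q (t e) e).
Proof.
move=> dt dQ.
apply: (@dd_ext _ (fun e => exists x, x = t e /\ Q x e)).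
  by move=> e; split=> [[x [->]] //|H]; exists (t e).
by apply: dd_ex; apply: dd_and.
Qed.

Lemma df_shift t : df t -> df (fun e => t (fun n => e n.+1)).
Proof. exact: (dd_subst (fun n => if n is n'.+1 then n'.+2 else 0%N)). Qed.

Lemma dd_app1 (P : num M -> Prop) t : dd (fun e => P (e 0%N)) -> df t ->
  dd (fun e => P (t e)).
Proof. by move=> dP dt; apply: (dd_at (Q := fun x _ => P x)). Qed.

Lemma dd_app2 (P : num M -> num M -> Prop) t u : dd (fun e => P (e 0%N) (e 1%N)) ->
  df t -> df u -> dd (fun e => P (t e) (u e)).
Proof.
move=> dP dt du; apply: (dd_at (Q := fun x e => P x (u e))) => //.
apply: (dd_at (Q := fun y e => P (e 0%N) y)); first exact: df_shift.
exact: (dd_args2 dP 1 0).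
Qed.

Lemma dd_app3 (P : num M -> num M -> num M -> Prop) t u v :
  dd (fun e => P (e 0%N) (e 1%N) (e 2%N)) ->
  df t -> df u -> df v -> dd (fun e => P (t e) (u e) (v e)).
Proof.
move=> dP dt du dv; apply: (dd_at (Q := fun x e => P x (u e) (v e))) => //.
apply: (dd_at (Q := fun y e => P (e 0%N) y (v (fun n => e n.+1)))); first exact: df_shift.
apply: (dd_at (Q := fun z e => P (e 1%N) (e 0%N) z)); first exact: (df_shift (df_shift dv)).
exact: (dd_args3 dP 2 1 0).
Qed.

Lemma df_app1 (F : num M -> num M) t : df (fun e => F (e 0%N)) -> df t ->
  df (fun e => F (t e)).
Proof.
move=> dF dt; apply: (@dd_app2 (fun x y => x = F y) (fun e => e 0%N)) => //.
  by apply: df_tm; apply: tm_var.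
exact: df_shift.
Qed.

Lemma df_app2 (F : num M -> num M -> num M) t u : df (fun e => F (e 0%N) (e 1%N)) ->
  df t -> df u -> df (fun e => F (t e) (u e)).
Proof.
move=> dF dt du; apply: (@dd_app3 (fun x y z => x = F y z) (fun e => e 0%N)) => //.
  by apply: df_tm; apply: tm_var.
all: exact: df_shift.
Qed.

Lemma df_add t u : df t -> df u -> df (fun e => t e + u e).
Proof. by move=> dt du; apply: df_app2 => //; apply: df_tm; tms. Qed.

Lemma df_mul t u : df t -> df u -> df (fun e => t e * u e).
Proof. by move=> dt du; apply: df_app2 => //; apply: df_tm; tms. Qed.

Lemma df_pair t u : df t -> df u -> df (fun e => pair (t e) (u e)).
Proof. by move=> dt du; apply: df_app2 => //; apply: df_tm; rewrite /pair; tms. Qed.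

Lemma df_eq t u : df t -> df u -> dd (fun e => t e = u e).
Proof. by move=> dt du; apply: (dd_app2 (P := fun x y => x = y)) => //; dds. Qed.

Lemma df_lt t u : df t -> df u -> dd (fun e => t e < u e).
Proof. by move=> dt du; apply: (dd_app2 (P := fun x y => x < y)) => //; dds. Qed.

Lemma df_le t u : df t -> df u -> dd (fun e => t e <= u e).
Proof. by move=> dt du; apply: (dd_app2 (P := fun x y => x <= y)) => //; dds. Qed.

Lemma df_mem (S : set (num M)) t : sets M S -> df t -> dd (fun e => S (t e)).
Proof. by move=> sS dt; apply: (dd_app1 (P := S)) => //; dds. Qed.

Definition is_least (P : num M -> Prop) y := P y /\ forall k, k < y -> ~ P k.

(* The least element of [P], or [0] when [P] is empty. *)
Definition mu (P : num M -> Prop) : num M :=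
  if pselect (exists y, is_least P y) is left h then projT1 (cid h) else 0.

Lemma muP (P : num M -> Prop) : dd (fun e => P (e 0%N)) -> (exists y, P y) -> is_least P (mu P).
Proof.
move=> dP [y Py]; have [m Pm mm] := least dP Py.
rewrite /mu; case: pselect => [h|[]]; first by case: (cid h).
by exists m.
Qed.

Lemma mu0 (P : num M -> Prop) : (forall y, ~ P y) -> mu P = 0.
Proof. by move=> H; rewrite /mu; case: pselect => // h; exfalso; case: h => y [/H]. Qed.

Lemma df_mu (P : num M -> env -> Prop) : dd (fun e => P (e 0%N) (fun n => e n.+1)) ->
  df (fun e => mu (fun y => P y e)).
Proof.
move=> dP; have dP' (e : env) : dd (fun e' => P (e' 0%N) e).
  exact: (dd_ext _ (dd_look (fun n => if n is k.+1 then inr (e k) else inl 0%N) dP)).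
have mP e := @muP (fun y => P y e) (dP' e).
apply: (@dd_ext _ (fun e => P (e 0%N) (fun n => e n.+1) /\
    (forall k, k < e 0%N -> ~ P k (fun n => e n.+1)) \/
    e 0%N = 0 /\ forall k, ~ P k (fun n => e n.+1))).
  move=> e; split=> [[[Pe le]|[-> H]]|E]; last 2 first.
  - by rewrite mu0.
  - case: (pselect (exists y, P y (fun n => e n.+1))) => [H|N].
      by left; case: (muP (dP' _) H); rewrite -E.
    have N' k : ~ P k (fun n => e n.+1) by move=> H; apply: N; exists k.
    by right; split=> //; rewrite E mu0.
  have [|Pm lm] := mP (fun n => e n.+1); first by exists (e 0%N).
  by case: (trichotomy (e 0%N) (mu (fun y => P y (fun n => e n.+1)))) => // [/lm|/le].
apply: dd_or; apply: dd_and => //.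
- apply: dd_ball; first exact: tm_var.
  by apply: dd_not; apply: (dd_subst (fun n => if n is n'.+1 then n'.+2 else 0%N) dP).
- by dds.
- apply: dd_all; apply: dd_not.
  exact: (dd_subst (fun n => if n is n'.+1 then n'.+2 else 0%N) dP).
Qed.

End ArithmeticalDefinability.

Ltac df_atom := fail.

Ltac dfs := cbv beta; lazymatch goal with
  | |- df (fun e => e ?n) => apply: df_tm; apply: tm_var
  | |- df (fun e => add _ _) => apply: df_add; dfs
  | |- df (fun e => mul _ _) => apply: df_mul; dfs
  | |- df (fun e => succ _) => apply: df_add; dfs
  | |- df (fun e => pair _ _) => apply: df_pair; dfs
  | |- df (fun e => triple _ _ _) => apply: df_pair; dfs
  | H : df (fun e => ?F (e 0) (e 1)) |- df (fun e => ?F _ _) => apply: (df_app2 (F := F) H); dfs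
  | H : df (fun e => ?F (e 0)) |- df (fun e => ?F _) => apply: (df_app1 (F := F) H); dfs
  | |- df _ => first [apply: df_tm; apply: tm_cst | df_atom; dfs | idtac]
  end.

Ltac dd_atom := fail.

(** In contrast to [dds], number quantifiers may be unbounded and arguments may be definable
    functions; both rest on arithmetical comprehension. *)
Ltac ddx := cbv beta; lazymatch goal with
  | |- dd (fun e => ~ _) => apply: dd_not; ddx
  | |- dd (fun e => _ /\ _) => apply: dd_and; ddx
  | |- dd (fun e => _ \/ _) => apply: dd_or; ddx
  | |- dd (fun e => _ <-> _) => apply: dd_iff; ddx
  | |- dd (fun e => @eq _ _ _) => apply: df_eq; dfs
  | |- dd (fun e => lt _ _) => apply: df_lt; dfs
  | |- dd (fun e => le _ _) => apply: df_le; dfs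
  | |- dd (fun e => exists x : num _, _) => apply: dd_ex; ddx
  | |- dd (fun e => forall x : num _, _) => apply: dd_all; ddx
  | |- dd (fun e => _ -> _) => apply: dd_imp; ddx
  | H : dd (fun e => ?P (e 0) (e 1) (e 2)) |- dd (fun e => ?P _ _ _) => apply: (dd_app3 (P := P) H); dfs
  | H : dd (fun e => ?P (e 0) (e 1)) |- dd (fun e => ?P _ _) => apply: (dd_app2 (P := P) H); dfs
  | H : dd (fun e => ?P (e 0)) |- dd (fun e => ?P _) => apply: (dd_app1 (P := P) H); dfs
  | H : sets _ ?S |- dd (fun e => ?S _) => apply: (df_mem (S := S) H); dfs
  | |- dd _ => first [apply: dd_cst | dd_atom; (ddx || dfs) | idtac]
  end.

(** * Coding of finite sequences *)

Section Coding.
Variable M : aca_model.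
Local Open Scope num_scope.
Local Notation "0" := (zero M) : num_scope.
Local Notation "1" := (one M) : num_scope.
Implicit Types x y z m n i k a b c v : num M.

Add Ring num_ring2 : (num_semiring M).

Definition dvd m x := exists z, x = z * m.

Lemma dvd_mulr m x y : dvd m x -> dvd m (x * y).
Proof. by move=> [z ->]; exists (z * y); ring. Qed.

Lemma dvd_mull m x y : dvd m x -> dvd m (y * x).
Proof. by move=> [z ->]; exists (y * z); ring. Qed.

(** There is no subtraction: when [z] exceeds [w], the equation [z * m + y = w * m] forces
    [y = 0]. *)
Lemma dvd_addr m x y : dvd m x -> dvd m (x + y) -> dvd m y.
Proof.
move=> [z ->] [w E]; case: (le_or_lt z w) => [/leP [d D]|/ltP [d D]].
  by exists d; apply: (@addnI _ (z * m)); rewrite E D; ring.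
exists 0; suff [_ ->] : d * m + m = 0 /\ y = 0 by ring.
apply: add_eq0; apply: (@addnI _ (w * m)).
by rewrite num_addn0 -[RHS]E D; ring.
Qed.

Lemma dvd_coprime b i k a : i <> k ->
  (forall d, i = k + d + 1 \/ k = i + d + 1 -> dvd (d + 1) b) ->
  dvd (1 + (i + 1) * b) (a * (1 + (k + 1) * b)) -> dvd (1 + (i + 1) * b) a.
Proof.
move=> ik db; set m := 1 + (i + 1) * b; set m' := 1 + (k + 1) * b => dm.
have mm : dvd m m by exists 1; ring.
suff [d [/db [b' E] D]] : exists d, (i = k + d + 1 \/ k = i + d + 1) /\ dvd m (a * (d + 1)).
  apply: (@dvd_addr _ (a * (d + 1) * (b' * (i + 1)))); first exact: dvd_mulr.
  have -> : a * (d + 1) * (b' * (i + 1)) + a = a * m by rewrite /m E; ring.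
  exact: dvd_mull.
case: (trichotomy i k) => [/ltP [d E]|//|/ltP [d E]]; exists d.
- split; first by right.
  apply: (@dvd_addr _ ((i + 1) * (a * m'))); first exact: dvd_mull.
  have -> : (i + 1) * (a * m') + a * (d + 1) = a * (k + 1) * m by rewrite /m /m' E; ring.
  exact: dvd_mull.
- split; first by left.
  apply: (@dvd_addr _ (a * (k + 1) * m)); first exact: dvd_mull.
  have -> : a * (k + 1) * m + a * (d + 1) = (i + 1) * (a * m') by rewrite /m /m' E; ring.
  exact: dvd_mull.
Qed.

(** A factorial. Positivity makes all moduli greater than 1, so that [a = 1] codes the empty set. *)
Lemma common_multiple n : exists b, 0 < b /\ forall d, d < n -> dvd (d + 1) b.
Proof.
move: n; apply: num_ind => [||n [b [b0 IH]]]; first by rewrite /dvd; ddx.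
  by exists 1; split=> [|d /num_lt0 //]; rewrite -[1 in X in _ < X]num_add0n; apply: lt_succ.
exists (b * (n + 1)); split.
  case: (num_case b) b0 => [->|[b' -> _]]; first by move/ltxx.
  by apply/ltP; exists (b' * n + b' + n); ring.
move=> d /num_ltS [/IH|->]; first exact: dvd_mulr.
by apply: dvd_mull; exists 1; ring.
Qed.

(* Membership of [i] in the set coded by [a] and [b] through Goedel's beta function. *)
Definition bmem i a b := dvd (1 + (i + 1) * b) a.

Lemma dd_bmem : dd (fun e => bmem (e 0%N) (e 1%N) (e 2%N)).
Proof. rewrite /bmem /dvd; ddx. Qed.

(** The code [a] is the product of the moduli of the members, which are pairwise coprime. *)
Lemma set_code (S : num M -> Prop) n : dd (fun e => S (e 0%N)) ->
  exists a b, forall i, i < n -> bmem i a b <-> S i.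
Proof.
move=> dS; have dB := dd_bmem; have [b [b0 db]] := common_multiple n.
suff /(_ n) [a Ha] : forall k, exists a, forall i, i < n -> bmem i a b <-> i < k /\ S i.
  by exists a, b => i iN; rewrite Ha //; split=> [[]|].
apply: num_ind => [||k [a IH]]; first by ddx.
  exists 1 => i _; split=> [[z]|[/num_lt0 //]].
  case: (num_case z) => [->|[z' ->]].
    by rewrite num_mul0n -[1]num_add0n => /num_succ_neq0.
  case: (num_case b) b0 => [->|[b' -> _] E]; first by move/ltxx.
  have : 0 + 1 = (z' * (1 + (i + 1) * (b' + 1)) + (i + 1) * b' + i + 1) + 1 by rewrite num_add0n; apply: etrans E _; ring.
  by move/num_succ_inj/esym/num_succ_neq0.
case: (pselect (k < n /\ S k)) => [[kn Sk]|N]; last first.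
  exists a => i iN; rewrite IH //; split=> -[ik Si]; split=> //.
    by apply/num_ltS; left.
  by move/num_ltS: ik => [//|E]; case: N; rewrite -E.
exists (a * (1 + (k + 1) * b)) => i iN.
case: (pselect (i = k)) => [->|ik].
  split=> _; last by apply: dvd_mull; exists 1; ring.
  by split=> //; apply: lt_succ.
rewrite num_ltS; have -> : i <= k <-> i < k by split=> [[//|/ik]|]; [|left].
rewrite -IH //; split; last exact: dvd_mulr.
apply: dvd_coprime => // d H; apply: db; case: H => E.
  by apply: le_lt_trans iN; apply/leP; exists (k + 1); rewrite E; ring.
by apply: le_lt_trans kn; apply/leP; exists (i + 1); rewrite E; ring.
Qed.

(** Total: each number codes some sequence. Many numbers code the same initial segment, hence
    [canon] below. *)
Definition dec c v : num M := mu (fun y => exists a b, c = pair a b /\ bmem (pair v y) a b).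

Lemma df_dec : df (fun e => dec (e 0%N) (e 1%N)).
Proof. have dB := dd_bmem; apply: df_mu; ddx. Qed.

(** The graph of the least choice [F] is coded as a set of pairs. Since [dec] takes least values,
    the code has to be right only for pairs with second component at most [F v], and these lie below
    one bound [N]. *)
Lemma finite_choice (P : num M -> num M -> Prop) n : dd (fun e => P (e 0%N) (e 1%N)) ->
  (forall v, v < n -> exists y, P v y) -> exists c, forall v, v < n -> P v (dec c v).
Proof.
move=> dP H; have dB := dd_bmem.
pose F v := mu (fun y => P v y).
have dF : df (fun e => F (e 0%N)) by apply: df_mu; ddx.
have FP v : v < n -> P v (F v).
  by move=> /H Hv; case: (muP (dd_section dP v) Hv).
have [N HN] : exists N, forall v, v < n -> pair v (F v) < N.
  move: (n); apply: num_ind => [||k [N IH]]; first by ddx.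
    by exists 0 => v /num_lt0.
  exists (N + pair k (F k) + 1) => v /num_ltS [/IH vk|->].
    by apply: (lt_le_trans vk); rewrite -num_addA; apply: le_addr.
  by apply/num_ltS; apply: le_addl.
have [|a [b Hab]] := @set_code (fun i => exists v, v < n /\ i = pair v (F v)) N.
  by ddx.
exists (pair a b) => v vn; suff -> : dec (pair a b) v = F v by apply: FP.
have memE y : y <= F v -> bmem (pair v y) a b <-> y = F v.
  move=> yF; rewrite Hab; last first.
    apply: le_lt_trans (HN _ vn); rewrite /pair.
    by apply: le_add; [apply: le_mul; apply: le_add; rewrite // /le; right | right].
  split=> [[v' [_ /pair_inj [-> //]]]|->]; by exists v.
have [||[a' [b' [/pair_inj [<- <-] Hm]]] lm] := @muP M
  (fun y => exists a' b', pair a b = pair a' b' /\ bmem (pair v y) a' b').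
- by ddx.
- by exists (F v), a, b; split=> //; apply/memE; [right|].
rewrite -/(dec (pair a b) v) in Hm lm *.
case: (trichotomy (dec (pair a b) v) (F v)) => [L|//|L].
  by apply/memE => //; left.
by case: (lm _ L); exists a, b; split=> //; apply/memE; [right|].
Qed.

Lemma bounding (P : num M -> num M -> Prop) n : dd (fun e => P (e 0%N) (e 1%N)) ->
  (forall v, v < n -> exists y, P v y) -> exists b, forall v, v < n -> exists y, y < b /\ P v y.
Proof.
move=> dP; move: n; apply: num_ind => [||n IH H]; first by ddx.
  by exists 0 => v /num_lt0.
case: IH => [v vn|b Hb]; first by apply: H; apply/num_ltS; left.
case: (H n (lt_succ n)) => y Py; exists (b + y + 1) => v /num_ltS [/Hb [y' [yb Py']]|->].
  by exists y'; split=> //; apply: lt_le_trans yb _; rewrite -num_addA; apply: le_addr.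
by exists y; split=> //; apply/num_ltS; apply: le_addl.
Qed.

(** Taking the least successor makes the choice a definable function [g]; its iteration is then
    primitive recursion by coded initial segments. *)
Lemma dependent_choice (S : num M -> Prop) (R : num M -> num M -> Prop) x0 :
  dd (fun e => S (e 0%N)) -> dd (fun e => R (e 0%N) (e 1%N)) -> S x0 ->
  (forall x, S x -> exists y, S y /\ R x y) ->
  exists f : num M -> num M, [/\ df (fun e => f (e 0%N)), f 0 = x0
    & forall n, S (f n) /\ R (f n) (f (n + 1))].
Proof.
move=> dS dR S0 H; have ddec := df_dec.
pose g x := mu (fun y => S y /\ R x y).
have dg : df (fun e => g (e 0%N)) by apply: df_mu; ddx.
have gP x : S x -> S (g x) /\ R x (g x).
  by move=> /H Hx; apply: (muP _ Hx).1; ddx.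
(* The code holds the values at 0 up to [n] inclusive. Codes are not unique, but [code_eq] shows
   that the values are. *)
pose code n c := dec c 0 = x0 /\ forall k, k < n -> dec c (k + 1) = g (dec c k).
have dcode : dd (fun e => code (e 0%N) (e 1%N)) by rewrite /code; ddx.
have code_ex : forall n, exists c, code n c.
  apply: num_ind => [||n [c [c0 cS]]]; first by ddx.
    case: (@finite_choice (fun _ y => y = x0) 1) => [||c Hc]; first by ddx.
      by move=> v _; exists x0.
    exists c; split=> [|k /num_lt0 //]; apply: Hc.
    by rewrite -[1]num_add0n; apply: lt_succ.
  case: (@finite_choice (fun v y => (v <= n /\ y = dec c v) \/
     (n < v /\ y = g (dec c n))) (n + 1 + 1)) => [||c' Hc]; first by ddx.
    move=> v _; case: (le_or_lt v n) => vn; [exists (dec c v)|exists (g (dec c n))].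
      by left.
    by right.
  have low v : v <= n -> dec c' v = dec c v.
    move=> vn; case: (Hc v) => [|[]//|[/lt_nle //]].
    by apply/num_ltS; left; apply/num_ltS.
  exists c'; split; first by rewrite low //; apply: le0x.
  move=> k /num_ltS [kn|->].
    by rewrite !low ?cS //; first [by left | by apply/leS].
  rewrite (low n); last by right.
  case: (Hc (n + 1)) => [|[/le_nlt []]|[]//]; exact: lt_succ.
have code_eq n c c' : code n c -> code n c' -> forall k, k <= n -> dec c k = dec c' k.
  move=> [c0 cS] [c0' cS']; apply: num_ind => [||k IH kn]; first by ddx.
    by rewrite c0 c0'.
  by rewrite cS ?cS' ?IH //; first [by apply/leS | by left; apply/leS].
have codeW n m c : m <= n -> code n c -> code m c.
  move=> mn [c0 cS]; split=> // k km; apply: cS; exact: lt_le_trans mn.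
pose f n := dec (mu (code n)) n.
have df_f : df (fun e => f (e 0%N)).
  rewrite /f; apply: (df_app2 ddec); last by dfs.
  by apply: (df_mu (P := fun y e => code (e 0%N) y)); ddx.
have fE n m c : code n c -> m <= n -> f m = dec c m.
  move=> Hc mn; apply: (code_eq m); [|exact: codeW mn Hc|by right].
  exact: (muP (dd_section dcode m) (code_ex m)).1.
have f0 : f 0 = x0.
  by have [c Hc] := code_ex 0; rewrite (fE _ _ _ Hc) ?Hc.1 //; right.
have fS n : f (n + 1) = g (f n).
  have [c Hc] := code_ex (n + 1); rewrite !(fE _ _ _ Hc); first by apply: Hc.2; apply: lt_succ.
    by left; apply: lt_succ.
  by right.
have Sf : forall n, S (f n).
  apply: num_ind => [||n Sn]; first by ddx.
    by rewrite f0.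
  by rewrite fS; apply: (gP _ Sn).1.
exists f; split=> // n; split=> //; rewrite fS; exact: (gP _ (Sf n)).2.
Qed.

End Coding.

Ltac df_atom ::= lazymatch goal with
  | |- df (fun e => dec _ _) => apply: (df_app2 (@df_dec _))
  end.

(** * Trees with at most one path *)

Section Sequences.
Variable M : aca_model.
Local Open Scope num_scope.
Local Notation "0" := (zero M) : num_scope.
Local Notation "1" := (one M) : num_scope.
Implicit Types x y z m n i k a b c v q : num M.

Definition ext n c c' := forall v, v < n -> dec c v = dec c' v.

(** Least codes represent each node by exactly one point; otherwise distinct codes of a node would
    be points that cannot be separated. *)
Definition canon n c := forall c', c' < c -> ~ ext n c c'.

Definition fcode (F : num M -> num M) n := mu (fun c => forall v, v < n -> dec c v = F v).

Lemma dd_ext_code : dd (fun e => ext (e 0%N) (e 1%N) (e 2%N)).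
Proof. rewrite /ext; ddx. Qed.

Lemma dd_canon : dd (fun e => canon (e 0%N) (e 1%N)).
Proof. rewrite /canon /ext; ddx. Qed.

Lemma ext_sym n c c' : ext n c c' -> ext n c' c.
Proof. by move=> H v vn; rewrite H. Qed.

Lemma ext_trans n c' c c'' : ext n c c' -> ext n c' c'' -> ext n c c''.
Proof. by move=> H H' v vn; rewrite H ?H'. Qed.

Lemma extW m n c c' : m <= n -> ext n c c' -> ext m c c'.
Proof. by move=> mn H v vm; apply: H; apply: lt_le_trans mn. Qed.

Lemma canon_inj n c c' : canon n c -> canon n c' -> ext n c c' -> c = c'.
Proof.
move=> H H' E; case: (trichotomy c c') => [/H'|//|/H]; first by case; apply: ext_sym.
by case.
Qed.

Lemma canon_ex n c : exists c', canon n c' /\ ext n c' c.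
Proof.
have dE := dd_ext_code.
have [||c' E H] := @least M (fun c' => ext n c' c) c; first by ddx.
  by [].
exists c'; split=> // k kc K; apply: (H k kc); apply: ext_trans E; exact: ext_sym.
Qed.

Lemma df_fcode (F : num M -> num M) : df (fun e => F (e 0%N)) -> df (fun e => fcode F (e 0%N)).
Proof. by move=> dF; rewrite /fcode; apply: df_mu; ddx. Qed.

Lemma fcodeP (F : num M -> num M) n : df (fun e => F (e 0%N)) ->
  (forall v, v < n -> dec (fcode F n) v = F v) /\ canon n (fcode F n).
Proof.
move=> dF.
have [||H1 H2] := @muP M (fun c => forall v, v < n -> dec c v = F v).
- by ddx.
- by apply: (finite_choice (P := fun v y => y = F v)) => [|v _]; [ddx | exists (F v)].
split=> // c' /H2 N E; apply: N => v vn; rewrite -E //; exact: H1.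
Qed.

Lemma fcode_eq (F : num M -> num M) n c : df (fun e => F (e 0%N)) -> canon n c ->
  (forall v, v < n -> dec c v = F v) -> c = fcode F n.
Proof.
move=> dF cc H; have [H1 H2] := fcodeP n dF.
by apply: (canon_inj cc H2) => v vn; rewrite H ?H1.
Qed.

(** The node of level [n] in tree [q]. The same triples later name the vertices of the evaluation of
    a formula. *)
Definition nd q n c : num M := pair (pair q n) c.

Lemma nd_inj q n c q' n' c' : nd q n c = nd q' n' c' -> [/\ q = q', n = n' & c = c'].
Proof. by move=> /pair_inj [/pair_inj [-> ->] ->]. Qed.

End Sequences.

Ltac df_atom ::= lazymatch goal with
  | |- df (fun e => dec _ _) => apply: (df_app2 (@df_dec _))
  | |- df (fun e => nd _ _ _) => rewrite /nd
  | H : df (fun e => ?F (e 0)) |- df (fun e => fcode ?F _) => apply: (df_app1 (df_fcode H))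
  end.

Ltac dd_atom ::= lazymatch goal with
  | |- dd (fun e => ext _ _ _) => apply: (dd_app3 (@dd_ext_code _))
  | |- dd (fun e => canon _ _) => apply: (dd_app2 (@dd_canon _))
  end.

Section UniquePath.
Variable M : aca_model.
Hypothesis choice : T2_locally_compact_have_choice M.
Local Open Scope num_scope.
Local Notation "0" := (zero M) : num_scope.
Local Notation "1" := (one M) : num_scope.
Implicit Types x y z m n i k a b c v q : num M.

(* [T q n c]: the first [n] values coded by [c] form a node of the [q]-th tree. *)
Variable T : num M -> num M -> num M -> Prop.
Hypothesis dT : dd (fun e => T (e 0%N) (e 1%N) (e 2%N)).
Hypothesis T_ext : forall q n c c', ext n c c' -> T q n c -> T q n c'.
Hypothesis T_down : forall q n m c, m <= n -> T q n c -> T q m c.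

(** Paths are compared below only if they are definable, which amounts to being functions of the
    model. *)
Definition path q (F : num M -> num M) : Prop :=
  forall n, exists c, (forall v, v < n -> dec c v = F v) /\ T q n c.

Hypothesis T_unique : forall q F F', df (fun e => F (e 0%N)) -> df (fun e => F' (e 0%N)) ->
  path q F -> path q F' -> forall v, F v = F' v.

Lemma path_fcode q F n : df (fun e => F (e 0%N)) -> path q F -> T q n (fcode F n).
Proof.
move=> dF pF; case: (pF n) => c [H]; apply: T_ext => v vn.
by rewrite H ?(fcodeP n dF).1.
Qed.

Definition child x y := exists q n c c', [/\ x = nd q n c, y = nd q (n + 1) c' & ext n c c'].

Lemma dd_child : dd (fun e => child (e 0%N) (e 1%N)).
Proof.
apply: (@dd_ext _ (fun e => exists q n c c',
  e 0%N = nd q n c /\ e 1%N = nd q (n + 1) c' /\ ext n c c')).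
  move=> e; split=> -[q [n [c [c' H]]]]; exists q, n, c, c'; first by case: H => ? [].
  by case: H.
ddx.
Qed.

(** Used for the nodes that refute compactness and for the nodes with infinite bounded cone. The
    last clause gives the label by which the path leaves the starting node. *)
Lemma path_through (S : num M -> Prop) q n c : dd (fun e => S (e 0%N)) ->
  (forall q n c, S (nd q n c) -> T q n c) ->
  (forall x, S x -> exists y, S y /\ child x y) -> S (nd q n c) ->
  exists F, [/\ df (fun e => F (e 0%N)), path q F, forall v, v < n -> F v = dec c v &
    exists c', S (nd q (n + 1) c') /\ F n = dec c' n].
Proof.
move=> dS ST Sc S0; have dch := dd_child.
have [f [df_f f0 Hf]] := dependent_choice dS dch S0 Sc.
pose cc k := mu (fun c => exists q n, f k = nd q n c).
have dcc : df (fun e => cc (e 0%N)) by apply: df_mu; ddx.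
have ccE k q1 n1 c1 : f k = nd q1 n1 c1 -> cc k = c1.
  move=> E; have [||[q2 [n2 E2]] _] := @muP M (fun c => exists q n, f k = nd q n c).
  - by ddx.
  - by exists c1, q1, n1.
  by have /nd_inj [_ _ ->] := etrans (esym E) E2.
have fE : forall k, f k = nd q (n + k) (cc k).
  apply: num_ind => [||k IH]; first by ddx.
    by rewrite num_addn0 (ccE _ _ _ _ f0).
  have [_ [q1 [n1 [c1 [c2 [E1 E2 _]]]]]] := Hf k.
  move: E1; rewrite IH => /nd_inj [Eq En _].
  by rewrite (ccE _ _ _ _ E2) E2 -Eq -En -num_addA.
have cS k : ext (n + k) (cc k) (cc (k + 1)).
  have [_ [q1 [n1 [c1 [c2 [E1 E2 E]]]]]] := Hf k.
  by rewrite (ccE _ _ _ _ E1) (ccE _ _ _ _ E2); move: E1; rewrite fE => /nd_inj [_ ->].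
have cm j d : ext (n + j) (cc j) (cc (j + d)).
  move: d; apply: num_ind => [||d IH]; first by ddx.
    by rewrite num_addn0.
  apply: (ext_trans IH); rewrite num_addA; apply: extW (cS _).
  by apply: le_add; [right | apply: le_addr].
have cmm j k : j <= k -> ext (n + j) (cc j) (cc k).
  by move=> /leP [d ->].
(* The node number [v + 1] has level [n + v + 1], which exceeds [v], so it fixes the value at
   [v]. *)
pose F v := dec (cc (v + 1)) v.
have FE j v : v < n + j -> F v = dec (cc j) v.
  move=> vj; rewrite /F; case: (le_or_lt j (v + 1)) => H; first by rewrite (cmm _ _ H).
  rewrite (cmm (v + 1) j) //; first by left.
  by apply: (lt_le_trans (lt_succ v)); apply: le_addl.
exists F; split.
- by rewrite /F; dfs.
- move=> N; exists (cc N); split=> [v vN|].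
    by rewrite -FE //; apply: (lt_le_trans vN); apply: le_addl.
  by apply: (T_down (le_addl N n)); apply: ST; rewrite -fE; case: (Hf N).
- move=> v vn; rewrite (FE 0) ?num_addn0 //; congr dec; exact: ccE f0.
- exists (cc 1); rewrite -fE; split; first by have [] := Hf 1.
  by apply: FE; apply: lt_succ.
Qed.

Definition tpt : set (num M) :=
  [set x | exists q n c, [/\ x = nd q n c, T q n c & canon n c]].

(* The cone above [x], without the children of [x] whose label is below [m]. *)
Definition tnb x m y : Prop := exists q n c n' c',
  [/\ x = nd q n c /\ y = nd q n' c', tpt x /\ tpt y, n <= n', ext n c c'
    & x = y \/ n < n' /\ m <= dec c' n].

Lemma tpt_nd q n c : tpt (nd q n c) <-> T q n c /\ canon n c.
Proof.
by split=> [[? [? [? [/nd_inj [-> -> ->]]]]] //|[t cn]]; exists q, n, c.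
Qed.

Lemma tnb_nd q n c m y : tnb (nd q n c) m y <-> exists n' c',
  [/\ y = nd q n' c', tpt (nd q n c) /\ tpt y, n <= n', ext n c c'
    & nd q n c = y \/ n < n' /\ m <= dec c' n].
Proof.
split=> [[? [? [? [n' [c' [[/nd_inj [<- <- <-] Ey] *]]]]]]|[n' [c' [Ey *]]]].
  by exists n', c'.
by exists q, n, c, n', c'.
Qed.

Lemma sets_tpt : sets M tpt.
Proof.
have -> : tpt = [set x | exists q n c, x = nd q n c /\ T q n c /\ canon n c].
  by apply/seteqP; split=> x [q [n [c H]]]; exists q, n, c; [case: H | case: H => ? []].
by apply: dd_comprehension; ddx.
Qed.

Lemma dd_tnb : dd (fun e => tnb (e 0%N) (e 1%N) (e 2%N)).
Proof.
have st := sets_tpt.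
apply: (@dd_ext _ (fun e => exists q n c n' c',
  (e 0%N = nd q n c /\ e 2%N = nd q n' c') /\ (tpt (e 0%N) /\ tpt (e 2%N)) /\ n <= n' /\
  ext n c c' /\ (e 0%N = e 2%N \/ n < n' /\ e 1%N <= dec c' n))).
  move=> e; split=> -[q [n [c [n' [c' H]]]]]; exists q, n, c, n', c'; last by case: H.
  by case: H => ? [? [? []]].
ddx.
Qed.

Lemma tnb_system : nbhd_system tpt tnb.
Proof.
split.
- exact: sets_tpt.
- exact: dd_tnb.
- by move=> x m y [? [? [? [? [? []]]]]].
- move=> x m Xx; case: (Xx) => q [n [c [E _ _]]]; exists q, n, c, n, c.
  by split=> //; [right | left].
- move=> x m m' y mm [q [n [c [n' [c' [E X nn e H]]]]]]; exists q, n, c, n', c'.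
  split=> //; case: H => [|[? H]]; [by left | right; split=> //; exact: le_trans H].
- move=> x m y m' z [q [n [c [n' [c' [[Ex Ey] [Xx Xy] nn e H]]]]]] N.
  rewrite Ey => /tnb_nd [n2 [c2 [Ez [_ Xz] nn' e' _]]].
  exists q, n, c, n2, c2; split=> //; first exact: le_trans nn'.
    by apply: (ext_trans e); apply: extW e'.
  case: H => [/esym //|[lt le]]; right; split; first exact: lt_le_trans nn'.
  by rewrite -e'.
Qed.

Lemma tnb_ext q n c m n' c' : tnb (nd q n c) m (nd q n' c') -> n <= n' /\ ext n c c'.
Proof. by move=> /tnb_nd [? [? [/nd_inj [_ -> ->]]]]. Qed.

Lemma tnb_label q n c m n' c' : tnb (nd q n c) m (nd q n' c') -> n < n' -> m <= dec c' n.
Proof.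
move=> /tnb_nd [? [? [/nd_inj [_ <- <-] _ _ _ [/nd_inj [_ E _]|[] //]]]].
by rewrite E => /ltxx.
Qed.

Lemma tnb_fst q n c m z : tnb (nd q n c) m z -> exists n' c', z = nd q n' c'.
Proof. by move=> /tnb_nd [n' [c' [-> _ _ _ _]]]; exists n', c'. Qed.

Lemma tnb_intro q n c m n' c' : tpt (nd q n c) -> tpt (nd q n' c') -> n < n' ->
  ext n c c' -> m <= dec c' n -> tnb (nd q n c) m (nd q n' c').
Proof.
move=> X X' nn e le; apply/tnb_nd; exists n', c'; split=> //; first by left.
by right.
Qed.

(** Incomparable nodes have disjoint cones. If [y] extends [x], the number [dec c' n + 1] removes
    from the cone of [x] the child leading to [y]. *)
Lemma tnb_separated x y : tpt x -> tpt y -> x <> y ->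
  exists m m', forall z, tnb x m z -> tnb y m' z -> False.
Proof.
have K q n c n' c' : n < n' -> ext n c c' -> forall z,
    tnb (nd q n c) (dec c' n + 1) z -> tnb (nd q n' c') 0 z -> False.
  move=> nn e z Hx Hy; have [n2 [c2 E]] := tnb_fst Hx; rewrite {}E in Hx Hy.
  have [nn2 e2] := tnb_ext Hy.
  have := tnb_label Hx (lt_le_trans nn nn2); rewrite -e2 //.
  by apply: lt_nle; apply: lt_succ.
move=> [q [n [c [Ex Tx Cx]]]] [q' [n' [c' [Ey Ty Cy]]]] N; rewrite {}Ex {}Ey in N *.
case: (pselect (q = q')) => [Eq|Nq]; last first.
  exists 0, 0 => z /tnb_fst [? [? ->]] /tnb_fst [? [? /nd_inj [E _ _]]]; exact: Nq.
rewrite -{}Eq in N Ty *.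
case: (pselect (n < n' /\ ext n c c')) => [[nn e]|N1].
  by exists (dec c' n + 1), 0; apply: K.
case: (pselect (n' < n /\ ext n' c' c)) => [[nn e]|N2].
  by exists 0, (dec c n' + 1) => z h1 h2; apply: (K _ _ _ _ _ nn e z h2 h1).
exists 0, 0 => z Hx Hy; have [n2 [c2 E]] := tnb_fst Hx; rewrite {}E in Hx Hy.
have [nx ex] := tnb_ext Hx; have [ny ey] := tnb_ext Hy.
case: (trichotomy n n') => [L|E|L].
- by apply: N1; split=> //; apply: (ext_trans ex); apply: ext_sym; apply: extW ey; left.
- apply: N; rewrite -E in Cy ey *; congr nd; apply: (canon_inj Cx Cy).
  exact: (ext_trans ex (ext_sym ey)).
- by apply: N2; split=> //; apply: (ext_trans ey); apply: ext_sym; apply: extW ex; left.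
Qed.

(* A node whose cone is not finitely covered has a child of the same kind, so
   that a failure of compactness gives a path. *)
Lemma tnb_compact q n c m :
  (forall F, df (fun e => F (e 0%N)) -> path q F -> (forall v, v < n -> F v = dec c v) ->
     m <= F n -> False) ->
  compact_subset (nbU tnb) [set z | tnb (nd q n c) m z].
Proof.
move=> noF; apply/compact_subsetP => I sI cov; apply: contrapT => nob.
set x := nd q n c in cov nob *; have dtnb := dd_tnb.
have dcol : dd (fun e => col (nbU tnb) (e 0%N) (e 1%N)).
  apply: (@dd_ext _ (fun e => exists x m, e 0%N = pair x m /\ tnb x m (e 1%N))); last by ddx.
  by move=> e; rewrite col_nbU.
(* No bounded part of the cover suffices for the part of the cone of [z] inside the given
   neighborhood. *)
pose bad z := tnb x m z /\ forall b, exists w, tnb z 0 w /\ (tnb x m w /\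
  forall i, i < b -> I i -> ~ col (nbU tnb) i w).
have dbad : dd (fun e => bad (e 0%N)) by rewrite /bad; ddx.
have anti y k w : tnb y k w -> tnb y 0 w by apply: (nb_anti tnb_system); apply: le0x.
case: (pselect (tpt x)) => [Xx|nX]; last first.
  by apply: nob; exists 0 => y [? [? [? [? [? [_ []]]]]]].
have bad0 : bad x.
  split; first exact: (nb_refl tnb_system).
  move=> b; apply: contrapT => N; apply: nob; exists b => y Hy.
  apply: contrapT => N'; apply: N; exists y; split; first exact: anti Hy.
  by split=> // i ib Ii Ci; apply: N'; exists i.
have [F [dF pF F1 [c' [[Hx _] F2]]]] : exists F, [/\ df (fun e => F (e 0%N)), path q F,
    forall v, v < n -> F v = dec c v & exists c', bad (nd q (n + 1) c') /\ F n = dec c' n].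
  apply: (path_through dbad) => //.
    by move=> q' n' c' [/(nb_dom tnb_system) [_ /tpt_nd []]].
  move=> z [xz badz]; case: (nb_dom tnb_system xz) => _ [q1 [n1 [c1 [Ez T1 C1]]]].
  case: (cov z xz) => i0 Ii0 /col_nbU [r [m0 [Ei0 rz]]].
  have rw w : tnb z m0 w -> tnb r m0 w.
    case: (pselect (z = r)) => [->//|N]; exact: (nb_open tnb_system rz N).
  apply: contrapT => nochild.
  (* The number [b] bounds the indices needed above the child of [z] with label [v]. The member of
     the cover containing [z] takes care of all labels from [m0] on, so only finitely many children
     remain. If none were bad, [bounding] would give one [b] for all of them. *)
  pose P v b := forall n2 c2, n1 < n2 -> dec c2 n1 = v -> tnb z 0 (nd q1 n2 c2) ->
     tnb x m (nd q1 n2 c2) -> exists i, i < b /\ (I i /\ col (nbU tnb) i (nd q1 n2 c2)).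
  have [||b Hb] := @bounding M P m0; first by rewrite /P; ddx.
    move=> v vm0; apply: contrapT => Nb.
    have [n2 [c2 [n12 [cv [zw xw]]]]] : exists n2 c2, n1 < n2 /\ dec c2 n1 = v /\
        tnb z 0 (nd q1 n2 c2) /\ tnb x m (nd q1 n2 c2).
      apply: contrapT => N; apply: Nb; exists 0 => n2 c2 h1 h2 h3 h4.
      by case: N; exists n2, c2.
    have [c3 [C3 E3]] := canon_ex (n1 + 1) c2.
    have [_ /tpt_nd [T2 C2]] := nb_dom tnb_system zw.
    have [_ E12] : n1 <= n2 /\ ext n1 c1 c2 by rewrite Ez in zw; apply: tnb_ext zw.
    have T3 : T q1 (n1 + 1) c3.
      by apply: T_ext (ext_sym E3) _; apply: T_down T2; apply/leS.
    have E13 : ext n1 c1 c3.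
      by apply: (ext_trans E12); apply: ext_sym; apply: extW E3; left; apply: lt_succ.
    have D3 : dec c3 n1 = v by rewrite E3 //; apply: lt_succ.
    have z3 : tnb z 0 (nd q1 (n1 + 1) c3).
      rewrite Ez; apply: tnb_intro => //; [exact/tpt_nd|exact/tpt_nd|exact: lt_succ|].
      exact: le0x.
    have x3 : tnb x m (nd q1 (n1 + 1) c3).
      case: (pselect (z = x)) => [zx|N]; last exact: (nb_open tnb_system xz N z3).
      move: zx; rewrite Ez => /nd_inj [Eq En Ec]; rewrite /x -Eq -En -Ec.
      apply: tnb_intro => //; [exact/tpt_nd|exact/tpt_nd|exact: lt_succ|].
      by rewrite D3 -cv; move: xw; rewrite /x -Eq -En => /tnb_label; apply.
    apply: nochild; exists (nd q1 (n1 + 1) c3); split; last by exists q1, n1, c1, c3.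
    split=> // b; apply: contrapT => N; apply: Nb; exists b => n4 c4 n14 cv4 z4 x4.
    apply: contrapT => N'; apply: N; exists (nd q1 n4 c4); split; last first.
      by split=> // i ib Ii Ci; apply: N'; exists i.
    have [_ /tpt_nd [T4 C4]] := nb_dom tnb_system z4.
    have [_ E14] : n1 <= n4 /\ ext n1 c1 c4 by rewrite Ez in z4; apply: tnb_ext z4.
    have E34 : ext (n1 + 1) c3 c4.
      move=> v' /num_ltS [lt|->]; last by rewrite D3 cv4.
      by rewrite -E13 // E14.
    apply/tnb_nd; exists n4, c4; split=> //; first by split; apply/tpt_nd.
      exact/leS.
    have /leS [lt|En4] := n14; first by right; split=> //; apply: le0x.
    left; rewrite -En4 in C4 *; congr nd; exact: (canon_inj C3 C4 E34).
  (* A point missed by all indices up to [i0] and below [b]. It is [z], or lies above a label at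
     least [m0], where [i0] covers it, or above a smaller label, where an index below [b] does. *)
  have [w [zw [xw Hw]]] := badz (b + i0 + 1).
  have i0b : i0 < b + i0 + 1 by apply/num_ltS; apply: le_addl.
  have no0 : ~ tnb z m0 w.
    by move=> /rw H; apply: (Hw i0 i0b Ii0); apply/col_nbU; exists r, m0.
  have [n2 [c2 Ew]] : exists n2 c2, w = nd q1 n2 c2 by rewrite Ez in zw; apply: tnb_fst zw.
  rewrite {}Ew in zw xw Hw no0.
  have [n12 E12] : n1 <= n2 /\ ext n1 c1 c2 by rewrite Ez in zw; apply: tnb_ext zw.
  have [_ /tpt_nd [T2 C2]] := nb_dom tnb_system zw.
  case: n12 => [n12|En]; last first.
    apply: no0; suff -> : nd q1 n2 c2 = z by apply: (nb_refl tnb_system); case: (nb_dom tnb_system zw).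
    by rewrite Ez -En in C2 *; congr nd; apply: esym; apply: canon_inj E12.
  case: (le_or_lt m0 (dec c2 n1)) => [le|lt].
    apply: no0; rewrite Ez; apply: tnb_intro => //; exact/tpt_nd.
  have [b' [b'b Pb]] := Hb _ lt; have [i [ib [Ii Ci]]] := Pb n2 c2 n12 erefl zw xw.
  apply: (Hw i) => //; apply: (lt_trans ib); apply: (lt_le_trans b'b).
  by rewrite -num_addA; apply: le_addr.
apply: (noF F dF pF F1); rewrite F2; apply: tnb_label (lt_succ n); exact: Hx.
Qed.

Lemma fcode_node q F n : df (fun e => F (e 0%N)) -> path q F -> tpt (nd q n (fcode F n)).
Proof.
by move=> dF pF; apply/tpt_nd; split; [exact: path_fcode | exact: (fcodeP n dF).2].
Qed.

Lemma fcode_ext F n n' : df (fun e => F (e 0%N)) -> n <= n' -> ext n (fcode F n) (fcode F n').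
Proof.
move=> dF nn v vn; rewrite (fcodeP n dF).1 // (fcodeP n' dF).1 //.
exact: lt_le_trans nn.
Qed.

(** If a path [F] passes through the node, the number [F n + 1] removes the child by which it
    continues, and uniqueness leaves no other path. The case distinction is not effective, which is
    where choice gains strength. *)
Lemma locally_compact_tree x : tpt x -> exists m K,
  [/\ sets M K, K `<=` tpt, compact_subset (nbU tnb) K & tnb x m `<=` K].
Proof.
move=> Xx; have dtnb := dd_tnb; case: (Xx) => q [n [c [Ex _ _]]].
suff [m Hm] : exists m, compact_subset (nbU tnb) [set z | tnb x m z].
  exists m, [set z | tnb x m z]; split=> //; first by apply: dd_comprehension; ddx.
  by move=> z /(nb_dom tnb_system) [].
rewrite Ex; case: (pselect (exists F, [/\ df (fun e => F (e 0%N)), path q F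
    & forall v, v < n -> F v = dec c v])) => [[F [dF pF Fc]]|N].
  exists (F n + 1); apply: tnb_compact => F' dF' pF' _; rewrite (T_unique dF' dF pF' pF).
  by apply: lt_nle; apply: lt_succ.
by exists 0; apply: tnb_compact => F dF pF Fc _; apply: N; exists F.
Qed.

(** Converse to the previous lemma: a neighborhood inside a compact set must omit the next node of
    the path. Otherwise the compact set contains all later nodes of the path, and these accumulate
    nowhere. *)
Lemma path_bound (C : set (num M)) :
  (forall x i, tpt x -> C (pair x i) -> exists y m, [/\ i = pair y m, tnb y m x
       & exists2 K, K `<=` tpt /\ compact_subset (nbU tnb) K & tnb x m `<=` K]) ->
  forall q F n m y, df (fun e => F (e 0%N)) -> path q F ->
    C (pair (nd q n (fcode F n)) (pair y m)) -> F n < m.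
Proof.
move=> HC q F n m y0 dF pF Cn; apply: nle_lt => mF.
case: (HC _ _ (fcode_node n dF pF) Cn) => y [m' [/pair_inj [_ <-] _]].
move=> [K [KX /compact_subsetP cK] NK].
have dtnb := dd_tnb.
have dcol : dd (fun e => col (nbU tnb) (e 0%N) (e 1%N)).
  apply: (@dd_ext _ (fun e => exists x m, e 0%N = pair x m /\ tnb x m (e 1%N))); last by ddx.
  by move=> e; rewrite col_nbU.
(* Basic sets that the path eventually leaves. At a node on the path, removing the next one
   suffices; the cone of any other node misses the path. A bounded subfamily is left at a common
   level, so it misses late nodes. *)
pose I := [set i | exists n0, forall k, n0 <= k -> ~ col (nbU tnb) i (nd q k (fcode F k))].
have sI : sets M I by apply: dd_comprehension; ddx.
case: (cK I sI) => [z Kz|b Hb].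
  have Xz := KX z Kz; case: (Xz) => q1 [n1 [c1 [Ez T1 C1]]].
  suff [m1 [n0 H]] : exists m1 n0, forall k, n0 <= k -> ~ tnb z m1 (nd q k (fcode F k)).
    exists (pair z m1); last by apply/col_nbU_pair/(nb_refl tnb_system).
    by exists n0 => k /H N /col_nbU_pair.
  case: (pselect (q = q1 /\ forall v, v < n1 -> dec c1 v = F v)) => [[Eq on]|off].
    exists (F n1 + 1), (n1 + 1) => k /leS nk; rewrite Ez -Eq => /tnb_label /(_ nk).
    by rewrite (fcodeP k dF).1 //; apply: lt_nle; apply: lt_succ.
  exists 0, 0 => k _; rewrite Ez => H; apply: off.
  have [n2 [c2 /nd_inj [Eq _ _]]] := tnb_fst H; rewrite {}Eq in H *; split=> // v vn.
  have [nk e] := tnb_ext H; rewrite e // (fcodeP k dF).1 //; exact: lt_le_trans nk.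
have [||B HB] := @bounding M (fun i n0 => I i -> forall k, n0 <= k ->
    ~ col (nbU tnb) i (nd q k (fcode F k))) b; first by ddx.
  move=> i _; case: (pselect (I i)) => [[n0 H]|N]; first by exists n0.
  by exists 0 => /N.
pose k := n + B + 1.
have nk : n < k by apply/num_ltS; apply: le_addr.
case: (Hb (nd q k (fcode F k))) => [|i [ib Ii Ci]].
  apply: NK; apply: tnb_intro => //; try exact: fcode_node.
    by apply: fcode_ext => //; left.
  by rewrite (fcodeP k dF).1.
case: (HB i ib) => n0 [n0B H]; apply: (H Ii k _ Ci); left.
by apply: (lt_trans n0B); apply/num_ltS; apply: le_addl.
Qed.

(** Nothing is claimed of [W q] if tree [q] has no path; the point is that [W] is fixed before
    [q]. *)
Lemma unique_path : exists W : num M -> num M -> num M,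
  df (fun e => W (e 0%N) (e 1%N)) /\
  forall q F, df (fun e => F (e 0%N)) -> path q F -> forall v, W q v = F v.
Proof.
case: (nbhd_choice tnb_system choice tnb_separated locally_compact_tree) => C [sC Ct Cf HC].
have FC := path_bound HC.
(* The subtree cut down by the chosen bounds is finitely branching, and by [path_bound] it still
   contains every path. *)
pose bounded q n c := T q n c /\ (canon n c /\ forall v, v < n -> forall c' y m,
  canon v c' -> ext v c' c -> C (pair (nd q v c') (pair y m)) -> dec c v < m).
have dG : dd (fun e => bounded (e 0%N) (e 1%N) (e 2%N)) by rewrite /bounded; ddx.
pose inf q n c := bounded q n c /\ forall N, exists n' c', N <= n' /\ (n <= n' /\
  (bounded q n' c' /\ ext n c c')).
have dinf : dd (fun e => inf (e 0%N) (e 1%N) (e 2%N)) by rewrite /inf; ddx.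
have bounded_path q F n : df (fun e => F (e 0%N)) -> path q F -> bounded q n (fcode F n).
  move=> dF pF; split; first exact: path_fcode.
  have [H1 H2] := fcodeP n dF; split=> // v vn c' y m Cc' e Cm; rewrite H1 //.
  suff Ec : c' = fcode F v by rewrite Ec in Cm; apply: FC Cm.
  apply: fcode_eq => // u uv; rewrite e // H1 //; exact: lt_trans vn.
have inf_path q F n : df (fun e => F (e 0%N)) -> path q F -> inf q n (fcode F n).
  move=> dF pF; split=> [|N]; first exact: bounded_path.
  exists (n + N), (fcode F (n + N)); split; first exact: le_addl.
  by split; [exact: le_addr | split; [exact: bounded_path | apply: fcode_ext => //; exact: le_addr]].
have inf_child q n c : inf q n c -> exists c', inf q (n + 1) c' /\ ext n c c'.
  move=> [[Tc [Cc Bc]] infc]; apply: contrapT => N.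
  have [i Ci] : exists i, C (pair (nd q n c) i) by apply: Ct; apply/tpt_nd.
  have [|y0 [m [Ei _ _]]] := HC _ _ _ Ci; first by apply/tpt_nd.
  rewrite {}Ei in Ci.
  (* If no child had infinite cone, then for each label [y < m] the cone above it would end at some
     level, and by bounding all would end below a common one. *)
  have [||b Hb] := @bounding M (fun y N => forall n' c', N <= n' -> n < n' ->
      bounded q n' c' -> ext n c c' -> dec c' n = y -> False) m; first by ddx.
    move=> y ym; apply: contrapT => NB.
    have inf_y k : exists n' c', k <= n' /\ n < n' /\ bounded q n' c' /\ ext n c c' /\ dec c' n = y.
      apply: contrapT => K; apply: NB; exists k => n' c' h1 h2 h3 h4 h5.
      by apply: K; exists n', c'.
    have [n1 [c1 [_ [nn1 [[T1 [C1 B1]] [E1 D1]]]]]] := inf_y 0.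
    have [c2 [C2 E2]] := canon_ex (n + 1) c1.
    have n1n : n + 1 <= n1 by apply/leS.
    have E12 : ext n c c2.
      by apply: (ext_trans E1); apply: ext_sym; apply: extW E2; left; apply: lt_succ.
    have D2 : dec c2 n = y by rewrite E2 //; apply: lt_succ.
    apply: N; exists c2; split=> //; split.
      split; first by apply: T_ext (ext_sym E2) _; apply: T_down T1.
      split=> // v vn c' y' m' Cc' e' Cm; rewrite E2 //.
      apply: (B1 v _ c' y' m') => //; first exact: lt_le_trans n1n.
      by apply: (ext_trans e'); apply: extW E2; left.
    move=> k; have [n3 [c3 [k3 [nn3 [B3 [E3 D3]]]]]] := inf_y k.
    exists n3, c3; split=> //; split; first exact/leS.
    split=> // v /num_ltS [vn|->]; last by rewrite D2 D3.
    by rewrite -E12 // E3.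
  have [n' [c' [Bn [_ [B' E']]]]] := infc (n + b + 1).
  have nn' : n < n' by apply: lt_le_trans Bn; apply/num_ltS; apply: le_addr.
  have ym : dec c' n < m by apply: B'.2.2 Ci.
  have [b' [b'b H]] := Hb _ ym; apply: (H n' c') => //; left.
  apply: (lt_trans b'b); apply: lt_le_trans Bn; apply/num_ltS; exact: le_addl.
pose W q v := mu (fun y => exists c, inf q (v + 1) c /\ y = dec c v).
have dW : df (fun e => W (e 0%N) (e 1%N)) by apply: df_mu; ddx.
exists W; split=> // q F dF pF v.
(* A node with infinite bounded cone lies on some path, which is [F] by uniqueness; hence every such
   node gives the right value at [v]. *)
have infF c : inf q (v + 1) c -> dec c v = F v.
  move=> ic; pose S x := exists n c, x = nd q n c /\ inf q n c.
  have [||||F' [dF' pF' F'c _]] := @path_through S q (v + 1) c.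
  - by rewrite /S; ddx.
  - by move=> q' n' c' [n1 [c1 [/nd_inj [-> -> ->] [[]]]]].
  - move=> x [n1 [c1 [Ex /inf_child [c2 [i2 e2]]]]]; exists (nd q (n1 + 1) c2).
    by split; [exists (n1 + 1), c2 | exists q, n1, c1, c2].
  - by exists (v + 1), c.
  by rewrite -F'c; [exact: (T_unique dF' dF pF' pF) | apply: lt_succ].
have [||[c [ic Ec]] _] := @muP M (fun y => exists c, inf q (v + 1) c /\ y = dec c v).
- by ddx.
- by exists (dec (fcode F (v + 1)) v), (fcode F (v + 1)); split=> //; apply: inf_path.
by rewrite -(infF c ic).
Qed.

End UniquePath.

(** * Transfinite search *)

Section TransfiniteSearch.
Variable M : aca_model.
Hypothesis choice : T2_locally_compact_have_choice M.
Local Open Scope num_scope.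
Local Notation "0" := (zero M) : num_scope.
Local Notation "1" := (one M) : num_scope.
Implicit Types x y z m n i k a b c v q : num M.

Variable R : num M -> num M -> Prop.
Hypothesis dR : dd (fun e => R (e 0%N) (e 1%N)).
Hypothesis R_trans : forall x y z, R x y -> R y z -> R x z.
Hypothesis R_ind : forall S : num M -> Prop, dd (fun e => S (e 0%N)) ->
  (forall v, (forall x, R x v -> S x) -> S v) -> forall v, S v.

Variable Phi : num M -> num M -> num M -> Prop.
Hypothesis dPhi : dd (fun e => Phi (e 0%N) (e 1%N) (e 2%N)).
Hypothesis Phi_indep : forall v x z z', ~ R x v -> Phi v x z -> Phi v x z'.

(** The value is 0 for false and [x + 1] for true with least witness [x]. Thus any wrong value is
    refuted by finitely many values of [F], and leastness makes the value unique. *)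
Definition search v (F : num M -> num M) y : Prop :=
  (y = 0 /\ forall x, ~ Phi v x (F x)) \/
  exists x, y = x + 1 /\ (Phi v x (F x) /\ forall x', x' < x -> ~ Phi v x' (F x')).

Lemma search_uniq v F F' y y' : (forall x, R x v -> F x = F' x) ->
  search v F y -> search v F' y' -> y = y'.
Proof.
move=> E; have H x : Phi v x (F x) <-> Phi v x (F' x).
  case: (pselect (R x v)) => [/E ->//|N]; split; exact: Phi_indep.
move=> [[-> N]|[x [-> [P L]]]] [[-> N']|[x' [-> [P' L']]]] //.
- by case: (N x'); apply/H.
- by case: (N' x); apply/H.
- by case: (trichotomy x x') => [/L' []|->//|/L []]; apply/H.
Qed.

Lemma search_ext v F F' y : (forall x, R x v -> F x = F' x) -> search v F y -> search v F' y.
Proof.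
move=> E; have H x : Phi v x (F x) <-> Phi v x (F' x).
  case: (pselect (R x v)) => [/E ->//|N]; split; exact: Phi_indep.
move=> [[-> N]|[x [-> [P L]]]]; first by left; split=> // x /H; apply: N.
by right; exists x; split=> //; split=> [|x' /L N /H //]; apply/H.
Qed.

Lemma search_ex v F : df (fun e => F (e 0%N)) -> exists y, search v F y.
Proof.
move=> dF; case: (pselect (exists x, Phi v x (F x))) => [[x0 P0]|N].
  have [||x P L] := @least M (fun x => Phi v x (F x)) x0; [by ddx|by []|].
  by exists (x + 1); right; exists x.
by exists 0; left; split=> // x P; apply: N; exists x.
Qed.

Definition down v q := v = q \/ R v q.

Lemma down_R x v q : R x v -> down v q -> down x q.
Proof. by move=> xv [<-|vq]; right=> //; apply: R_trans vq. Qed.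

Lemma down_trans u v q : down u v -> down v q -> down u q.
Proof. by move=> [->//|uv]; apply: down_R. Qed.

Lemma search_agree F F' q : df (fun e => F (e 0%N)) -> df (fun e => F' (e 0%N)) ->
  (forall v, down v q -> search v F (F v)) -> (forall v, down v q -> search v F' (F' v)) ->
  forall v, down v q -> F v = F' v.
Proof.
move=> dF dF' H H'; apply: R_ind => [|v IH vq]; first by rewrite /down; ddx.
apply: (search_uniq _ (H v vq) (H' v vq)) => x xv; apply: IH => //; exact: down_R vq.
Qed.

(** The value 0 off the vertices below [q] makes a solution unique as a total function. *)
Definition solves q (F : num M -> num M) : Prop :=
  forall v, (~ down v q -> F v = 0) /\ (down v q -> search v F (F v)).

(** The part of [solves] that concerns arguments below [n] only: a property of the first [n] values,
    inherited by shorter segments. *)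
Definition solves_upto q n (F : num M -> num M) : Prop :=
  forall v, v < n -> (~ down v q -> F v = 0) /\ (down v q ->
    (F v = 0 -> forall x, x < n -> ~ Phi v x (F x)) /\
    forall x, F v = x + 1 -> (x < n -> Phi v x (F x)) /\
      forall x', x' < x -> x' < n -> ~ Phi v x' (F x')).

Lemma solves_upto_ext q n F F' : (forall v, v < n -> F v = F' v) ->
  solves_upto q n F -> solves_upto q n F'.
Proof.
move=> E H v vn; case: (H v vn); rewrite (E v vn) => H1 H2; split=> // /H2 [H3 H4].
split=> [F0 x xn|x Fx]; first by rewrite -E //; exact: H3.
by case: (H4 x Fx) => H5 H6; split=> [xn|x' xx xn]; rewrite -E //; [exact: H5 | exact: H6].
Qed.

Lemma solves_upto_down q n m F : m <= n -> solves_upto q n F -> solves_upto q m F.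
Proof.
move=> mn H v vm; case: (H v (lt_le_trans vm mn)) => H1 H2; split=> // /H2 [H3 H4].
split=> [F0 x xn|x Fx]; first by apply: H3 => //; apply: lt_le_trans mn.
case: (H4 x Fx) => H5 H6; split=> [xn|x' xx xn].
  by apply: H5; apply: lt_le_trans mn.
by apply: H6 => //; apply: lt_le_trans mn.
Qed.

Lemma solves_uptoP q F : solves q F <-> forall n, solves_upto q n F.
Proof.
split=> [H n v _|H v].
  case: (H v) => H1 H2; split=> // /H2 [[E N]|[x [E [P L]]]].
    by split=> [_ x _|x]; [exact: N | rewrite E => /esym /num_succ_neq0].
  split=> [|x']; first by rewrite E => /num_succ_neq0.
  by rewrite E => /num_succ_inj <-; split=> // x'' xx _; apply: L.
(* Level [v + x + 1] sees both the vertex [v] and the candidate [x]. *)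
have vv x : v < v + x + 1 by apply/num_ltS; apply: le_addr.
have xv x : x < v + x + 1 by apply/num_ltS; apply: le_addl.
split=> [|vq]; first exact: (H _ v (vv 0)).1.
case: (num_case (F v)) => [E|[x E]]; [left|right].
  by split=> // x; apply: ((H _ v (vv x)).2 vq).1.
exists x; split=> //; split=> [|x' xx].
  by apply: (((H _ v (vv x)).2 vq).2 x E).1.
apply: (((H _ v (vv x)).2 vq).2 x E).2 => //; exact: lt_trans (xv x).
Qed.

Lemma transfinite_search : exists F : num M -> num M, df (fun e => F (e 0%N)) /\
  forall v, search v F (F v).
Proof.
pose T q n c := solves_upto q n (dec c).
have dT : dd (fun e => T (e 0%N) (e 1%N) (e 2%N)) by rewrite /T /solves_upto /down; ddx.
have pathE q F : df (fun e => F (e 0%N)) -> path T q F <-> solves q F.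
  move=> dF; rewrite solves_uptoP; split=> H n.
    case: (H n) => c [cF]; exact: solves_upto_ext.
  exists (fcode F n); have cF := (fcodeP n dF).1; split=> //.
  by apply: solves_upto_ext (H n) => v vn; rewrite cF.
have [|||W [dW HW]] := @unique_path M choice T dT.
- by move=> q n c c'; apply: solves_upto_ext.
- by move=> q n m c; apply: solves_upto_down.
- move=> q F F' dF dF' /(pathE _ _ dF) sF /(pathE _ _ dF') sF' v.
  case: (pselect (down v q)) => vq; last by rewrite (sF v).1 ?(sF' v).1.
  by apply: (search_agree dF dF' (q := q)) => // u; [case: (sF u) | case: (sF' u)].
have dWq q : df (fun e => W q (e 0%N)) by apply: (df_app2 dW); dfs.
(* Induction along [R] is allowed because [W] is a single definable function, which makes this
   statement arithmetical. *)
have solW : forall q, solves q (W q).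
  apply: R_ind => [|q IH]; first by rewrite /solves /search /down; ddx.
  have sW x v : R x q -> down v x -> search v (W x) (W x v) by move=> xq; apply: (IH x xq v).2.
  have agr x v : R x q -> down v x -> W x v = W v v.
    move=> xq vx; have vq : R v q by case: vx => [->//|/R_trans]; apply.
    apply: (search_agree (dWq x) (dWq v) (q := v)); last by left.
      by move=> u uv; apply: sW => //; apply: down_trans vx.
    by move=> u; apply: sW.
  (* The solutions below the predecessors of [q] agree, so their diagonal solves everything strictly
     below [q]. Adding a value at [q] gives a solution [G], a path of tree [q], which [W q] must
     therefore equal. *)
  pose D v := mu (fun y => R v q /\ y = W v v).
  have dD : df (fun e => D (e 0%N)) by apply: df_mu; ddx.
  have DE v : R v q -> D v = W v v.
    move=> vq; have [||[_ E] _] := @muP M (fun y => R v q /\ y = W v v); [by ddx| |exact: E].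
    by exists (W v v).
  have sD v : R v q -> search v D (W v v).
    move=> vq; apply: (@search_ext v (W v)) => [x xv|]; last by apply: sW => //; left.
    by rewrite DE ?(agr v) //; [right | apply: R_trans vq].
  have [y0 Hy0] := search_ex q dD.
  have Rirr : ~ R q q.
    suff : forall v, ~ R v v by exact.
    by apply: R_ind => [|v H vv]; [ddx | exact: (H v vv vv)].
  pose G v := mu (fun y => (R v q /\ y = D v) \/ (v = q /\ y = y0)).
  have dG : df (fun e => G (e 0%N)) by apply: df_mu; ddx.
  have GR v : R v q -> G v = D v.
    move=> vq; have [||[[_ E]|[E _]] _] := @muP M (fun y => (R v q /\ y = D v) \/ (v = q /\ y = y0)).
    - by ddx.
    - by exists (D v); left.
    - exact: E.
    - by case: Rirr; rewrite -{1}E.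
  have Gq : G q = y0.
    have [||[[//]|[_ E]] _] := @muP M (fun y => (R q q /\ y = D q) \/ (q = q /\ y = y0)).
    - by ddx.
    - by exists y0; right.
    - exact: E.
  have sG : solves q G.
    move=> v; split=> [N|].
      by apply: mu0 => y [[vq _]|[E _]]; apply: N; [right | left].
    move=> [->|vq].
      by rewrite Gq; apply: search_ext Hy0 => x xq; rewrite GR.
    rewrite GR // DE //; apply: search_ext (sD v vq) => x xv.
    by rewrite GR //; apply: R_trans vq.
  have WG v : W q v = G v by apply: HW => //; apply/pathE.
  suff -> : W q = G by [].
  exact/funext.
exists (fun v => W v v); split; first by dfs.
move=> v; apply: (@search_ext v (W v)); last by apply: (solW v v).2; left.
move=> x xv; apply: (search_agree (dWq v) (dWq x) (q := x)); last by left.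
  by move=> u ux; apply: (solW v u).2; right; case: ux => [->//|/R_trans]; apply.
by move=> u; apply: (solW x u).2.
Qed.

End TransfiniteSearch.

(** * Iteration along a well order *)

(** Implication and existential quantification each say that some vertex has a value passing a test
    on that value alone, as [search] requires. The other connectives are reduced to these two. *)
Definition neg (A : formula) : formula := Imp A (Lt Zero Zero).

Fixpoint reduce (A : formula) : formula :=
  match A with
  | Not B => neg (reduce B)
  | And B C => neg (Imp (reduce B) (neg (reduce C)))
  | Or B C => Imp (neg (reduce B)) (reduce C)
  | Imp B C => Imp (reduce B) (reduce C)
  | AllNum B => neg (ExNum (neg (reduce B)))
  | ExNum B => ExNum (reduce B)
  | _ => A
  end.

Fixpoint reduced (A : formula) : Prop :=
  match A with
  | Eq _ _ | Lt _ _ | Mem _ _ => True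
  | Imp B C => reduced B /\ reduced C
  | ExNum B => reduced B
  | _ => False
  end.

Lemma reduce_reduced A : arithmetical A -> reduced (reduce A).
Proof.
elim: A => //=; try by move=> B IHB C IHC [/IHB ? /IHC ?].
all: by move=> B IH /IH.
Qed.

Lemma sat_reduce (M : rca_model) A (e : nat -> num M) s : sat e s (reduce A) <-> sat e s A.
Proof.
have F : ~ (zero M < zero M)%M by exact: num_lt0.
elim: A e s => //=.
- by move=> B IH e s; rewrite IH; split=> [H /H /F|H /H].
- move=> B IHB C IHC e s; rewrite IHB IHC; split=> [H|[b c] H]; last exact: H.
  by split; apply: contrapT => N; apply: F; apply: H => b c; case: N.
- move=> B IHB C IHC e s; rewrite IHB IHC; split=> [H|[b /(_ b)/F//|//]].
  by case: (pselect (sat e s B)) => b; [left | right; apply: H].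
- by move=> B IHB C IHC e s; rewrite IHB IHC.
- move=> B IH e s; split=> [H x|H [x K]]; last by apply: K; apply/IH.
  by apply: contrapT => N; apply: F; apply: H; exists x => /IH.
- by move=> B IH e s; split=> -[x /IH H]; exists x.
Qed.

(* The subformulas of a reduced formula are numbered in prefix order. *)
Fixpoint fsize (A : formula) : nat :=
  match A with
  | Imp B C => (fsize B + fsize C).+1
  | ExNum B => (fsize B).+1
  | _ => 1
  end.

Section WellOrder.
Variable M : aca_model.
Local Open Scope num_scope.
Local Notation "0" := (zero M) : num_scope.
Local Notation "1" := (one M) : num_scope.
Variable X : set (num M).
Hypotheses (sX : sets M X) (woX : well_order X).

Lemma dd_rlt : dd (fun e => rlt X (e 0%N) (e 1%N)).
Proof. rewrite /rlt; ddx. Qed.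

Lemma rlt_trans i j l : rlt X i j -> rlt X j l -> rlt X i l.
Proof.
case: woX => -[_ tr _ _] _ [ij ji] [jl lj]; split; first exact: tr jl.
by move=> li; apply: lj; apply: tr li ij.
Qed.

Lemma rlt_field i j : rlt X i j -> field X i /\ field X j.
Proof. by case: woX => -[rf _ _ _] _ [/rf]. Qed.

(** A counterexample yields by dependent choice a descending sequence that is a set of the model. A
    number outside the field has nothing below it, so the hypothesis already gives [S] there. *)
Lemma well_order_induction (S : num M -> Prop) : dd (fun e => S (e 0%N)) ->
  (forall j, (forall i, rlt X i j -> S i) -> S j) -> forall j, S j.
Proof.
move=> dS IH j; apply: contrapT => Nj; case: woX => _; apply.
have dr := dd_rlt.
pose B i := field X i /\ ~ S i.
have dB : dd (fun e => B (e 0%N)) by rewrite /B /field /=; ddx.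
have desc i : ~ S i -> exists i', B i' /\ rlt X i' i.
  move=> Ni; apply: contrapT => N; apply/Ni/IH => i' ii; apply: contrapT => N'.
  by apply: N; exists i'; split=> //; split=> //; case: (rlt_field ii).
have [j0 [B0 _]] := desc j Nj.
have dgt : dd (fun e => rlt X (e 1%N) (e 0%N)) by ddx.
have [|f [df_f f0 Hf]] := @dependent_choice M B (fun x y => rlt X y x) j0 dB dgt B0.
  by move=> x [_ /desc].
exists [set p | exists n, p = pair n (f n)]; split.
- by apply: dd_comprehension; ddx.
- split; last by move=> a _; exists (f a), a.
  split; first by move=> p [n ->]; exists n, (f n); split=> //; case: (Hf n) => -[].
  by move=> a b c [n [/pair_inj [-> ->]]] [n' [/pair_inj [<- ->]]].
- move=> n a b [n' [/pair_inj [<- ->]]] [n2 [/pair_inj [<- ->]]].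
  by case: (Hf n).
Qed.

End WellOrder.

(** * Truth along a well order as a transfinite search *)

Section Iteration.
Variable M : aca_model.
Hypothesis choice : T2_locally_compact_have_choice M.
Local Open Scope num_scope.
Local Notation "0" := (zero M) : num_scope.
Local Notation "1" := (one M) : num_scope.
Variable X : set (num M).
Hypotheses (sX : sets M X) (woX : well_order X).
Variables (e0 : nat -> num M) (s0 : nat -> set (num M)).
Hypothesis s0_sets : forall i, sets M (s0 i).

Definition pfst (t : num M) : num M := mu (fun a => exists b, t = pair a b).
Definition psnd (t : num M) : num M := mu (fun b => exists a, t = pair a b).

Lemma df_pfst : df (fun e => pfst (e 0%N)).
Proof. by apply: df_mu; ddx. Qed.

Lemma df_psnd : df (fun e => psnd (e 0%N)).
Proof. by apply: df_mu; ddx. Qed.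

Lemma pfst_pair a b : pfst (pair a b) = a.
Proof.
have [||[c /pair_inj [E _]] _] := @muP M (fun a' => exists b', pair a b = pair a' b').
- by ddx.
- by exists a, b.
by rewrite [RHS]E.
Qed.

Lemma psnd_pair a b : psnd (pair a b) = b.
Proof.
have [||[c /pair_inj [_ E]] _] := @muP M (fun b' => exists a', pair a b = pair a' b').
- by ddx.
- by exists b, a.
by rewrite [RHS]E.
Qed.

(* The environment coded by [t] under [d] quantifiers. *)
Fixpoint envd (d : nat) (t : num M) : nat -> num M :=
  if d is d'.+1 then scons (pfst t) (envd d' (psnd t)) else scons t e0.

Lemma envd_pair d y t : envd d.+1 (pair y t) = scons y (envd d t).
Proof. by rewrite /= pfst_pair psnd_pair. Qed.

Lemma df_envd d k : df (fun e => envd d (e 0%N) k).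
Proof.
have d1 := df_pfst; have d2 := df_psnd.
elim: d k => [|d IH] [|k] /=; try by dfs.
exact: (df_app1 (F := fun t => envd d t k) (IH k) d2).
Qed.

Lemma df_eval d u : df (fun e => eval (envd d (e 0%N)) u).
Proof.
elim: u => [n|||a IHa b IHb|a IHa b IHb] /=; try by dfs.
exact: df_envd.
Qed.

Definition numeral (p : nat) : num M := iter p (fun x => x + 1) 0.

Arguments numeral : simpl never.

Lemma numeral_lt p q : (p < q)%N -> numeral p < numeral q.
Proof.
elim: q => // q IH; rewrite ltnS leq_eqVlt => /orP [/eqP ->|/IH H]; apply/num_ltS.
  by right.
by left.
Qed.

Lemma numeral_inj p q : numeral p = numeral q -> p = q.
Proof.
case: (ltngtP p q) => // /numeral_lt /lt_neq; first by [].
by move=> N /esym.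
Qed.

(* The search that evaluates [A]: the vertex [nd p i t] stands for the truth of
   the [p]-th subformula at stage [i] under the environment coded by [t]. *)
Fixpoint Phi (A : formula) (p d : nat) (v x z : num M) : Prop :=
  match A with
  | Eq a b => exists i t, v = nd (numeral p) i t /\ eval (envd d t) a = eval (envd d t) b
  | Lt a b => exists i t, v = nd (numeral p) i t /\ eval (envd d t) a < eval (envd d t) b
  | Mem a 0 => exists i t m i', v = nd (numeral p) i t /\ (eval (envd d t) a = pair m i' /\
      (rlt X i' i /\ (x = nd 0 i' m /\ z <> 0)))
  | Mem a k.+1 => exists i t, v = nd (numeral p) i t /\ s0 k (eval (envd d t) a)
  | Imp B C => (exists i t, v = nd (numeral p) i t /\
        ((x = nd (numeral p.+1) i t /\ z = 0) \/
         (x = nd (numeral (p.+1 + fsize B)) i t /\ z <> 0))) \/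
      (Phi B p.+1 d v x z \/ Phi C (p.+1 + fsize B) d v x z)
  | ExNum B => (exists i t y, v = nd (numeral p) i t /\
        (x = nd (numeral p.+1) i (pair y t) /\ z <> 0)) \/ Phi B p.+1 d.+1 v x z
  | _ => False
  end.

Lemma dd_Phi A p d : reduced A -> dd (fun e => Phi A p d (e 0%N) (e 1%N) (e 2%N)).
Proof.
have dr := dd_rlt sX; have dev d' a := df_eval d' a.
elim: A p d => //=.
- move=> a b p d _; have da := dev d a; have db := dev d b.
  do 2!apply: dd_ex; apply: dd_and; first by ddx.
  by apply: df_eq; [apply: (df_app1 (F := fun t => eval (envd d t) a) da) | apply: (df_app1 (F := fun t => eval (envd d t) b) db)]; dfs.
- move=> a b p d _; have da := dev d a; have db := dev d b.
  do 2!apply: dd_ex; apply: dd_and; first by ddx.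
  by apply: df_lt; [apply: (df_app1 (F := fun t => eval (envd d t) a) da) | apply: (df_app1 (F := fun t => eval (envd d t) b) db)]; dfs.
- move=> a [|k] p d _; have da := dev d a.
    do 4!apply: dd_ex; apply: dd_and; first by ddx.
    apply: dd_and; last by ddx.
    by apply: df_eq; [apply: (df_app1 (F := fun t => eval (envd d t) a) da) | ]; dfs.
  do 2!apply: dd_ex; apply: dd_and; first by ddx.
  by apply: df_mem; [exact: s0_sets | apply: (df_app1 (F := fun t => eval (envd d t) a) da)]; dfs.
- move=> B IHB C IHC p d [rB rC].
  by apply: dd_or; [ddx | apply: dd_or; [exact: IHB | exact: IHC]].
- by move=> B IHB p d rB; apply: dd_or; [ddx | exact: IHB].
Qed.

(** Disjoint subformulas use disjoint intervals of numbers, so at a given vertex only the clause of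
    its own subformula can hold. *)
Lemma Phi_index A p d v x z : Phi A p d v x z ->
  exists p' i t, [/\ v = nd (numeral p') i t, (p <= p')%N & (p' < p + fsize A)%N].
Proof.
have H (B : formula) q i t : v = nd (numeral q) i t -> exists p' i t,
    [/\ v = nd (numeral p') i t, (q <= p')%N & (p' < q + (fsize B).-1.+1)%N].
  by move=> ->; exists q, i, t; rewrite leqnn addnS ltnS leq_addr.
elim: A p d => //=.
- by move=> a b p d [i [t [/(H (Eq a b))]]].
- by move=> a b p d [i [t [/(H (Eq a b))]]].
- by move=> a [|k] p d; [case=> i [t [m [i' [/(H (Mem a 0))]]]] | case=> i [t [/(H (Mem a 0))]]].
- move=> B IHB C IHC p d [[i [t [/(H (Imp B C))]]]|[/IHB|/IHC]] //.
    move=> [p' [i [t [-> h1 h2]]]]; exists p', i, t; split=> //; first exact: ltnW.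
    by apply: leq_trans h2 _; rewrite addSnnS leq_add2l ltnS leq_addr.
  move=> [p' [i [t [-> h1 h2]]]]; exists p', i, t; split=> //.
    by apply: leq_trans h1; rewrite addSnnS leq_addr.
  by rewrite -addSnnS addnA.
- move=> B IHB p d [[i [t [y [/(H (ExNum B))]]]]|/IHB] //.
  move=> [p' [i [t [-> h1 h2]]]]; exists p', i, t; split=> //; first exact: ltnW.
  by rewrite -addSnnS.
Qed.

Section Evaluation.
Variable A : formula.
Hypothesis rA : reduced A.

(** Earlier stages come first; within a stage, subformulas lie below the formula and have larger
    numbers in prefix order. The bound by the size keeps this part well-founded. *)
Definition vlt (x v : num M) : Prop := exists p i t p' i' t',
  v = nd p i t /\ (x = nd p' i' t' /\
    (rlt X i' i \/ (i' = i /\ (p < p' /\ p' < numeral (fsize A))))).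

Lemma dd_vlt : dd (fun e => vlt (e 0%N) (e 1%N)).
Proof. have dr := dd_rlt sX; rewrite /vlt; ddx. Qed.

Lemma vlt_nd x p i t : vlt x (nd p i t) <-> exists p' i' t', x = nd p' i' t' /\
  (rlt X i' i \/ (i' = i /\ (p < p' /\ p' < numeral (fsize A)))).
Proof.
split=> [[? [? [? [p' [i' [t' [/nd_inj [<- <- _] H]]]]]]]|[p' [i' [t' H]]]].
  by exists p', i', t'.
by exists p, i, t, p', i', t'.
Qed.

Lemma vlt_trans x y z : vlt x y -> vlt y z -> vlt x z.
Proof.
move=> xy [p [i [t [p' [i' [t' [Ez [Ey H]]]]]]]].
move: xy; rewrite Ey => /vlt_nd [p2 [i2 [t2 [Ex H2]]]].
exists p, i, t, p2, i2, t2; split=> //; split=> //.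
case: H H2 => [H|[<- [h1 h2]]] [H'|[E [h3 h4]]]; [left..|right].
- exact: (rlt_trans woX) H' H.
- by rewrite E.
- exact: H'.
- by split=> //; split=> //; apply: lt_trans h3.
Qed.

Lemma vlt_induction (S : num M -> Prop) : dd (fun e => S (e 0%N)) ->
  (forall v, (forall x, vlt x v -> S x) -> S v) -> forall v, S v.
Proof.
move=> dS IH v; apply: (IH) => _ [_ [_ [_ [p [i [t [_ [-> _]]]]]]]].
suff : forall i p t, S (nd p i t) by exact.
move=> {v p t} {}i; apply: (well_order_induction sX woX (S := fun i => forall p t, S (nd p i t))).
  by ddx.
move=> {}i IHi p t; set L := numeral (fsize A).
(* Inner induction on the distance [k] from [p] to the size. At [k = 0] no vertex of the same stage
   lies below. *)
suff H : forall k p t, L <= p + k -> S (nd p i t) by apply: (H L); apply: le_addl.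
move=> {p t}; apply: num_ind => [||k IHk] /=; first by ddx.
  move=> p t; rewrite num_addn0 => Lp; apply: IH => _ /vlt_nd [p' [i' [t' [-> [/IHi //|[_ [h1 h2]]]]]]].
  by case: (lt_nle (lt_trans h1 h2)).
move=> p t Lp; apply: IH => _ /vlt_nd [p' [i' [t' [-> [/IHi //|[-> [/leS h1 h2]]]]]]].
apply: IHk; apply: le_trans Lp _; rewrite [k + 1]num_addC num_addA.
by apply: le_add => //; right.
Qed.

Lemma Phi_indep B p d v x z z' : (p + fsize B <= fsize A)%N -> ~ vlt x v ->
  Phi B p d v x z -> Phi B p d v x z'.
Proof.
have R q q' i t t' : (q < q')%N -> (q' < fsize A)%N ->
    vlt (nd (numeral q') i t') (nd (numeral q) i t).
  move=> qq qA; apply/vlt_nd; exists (numeral q'), i, t'; split=> //; right.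
  by split=> //; split; apply: numeral_lt.
have fsize_gt0 C : (0 < fsize C)%N by case: C.
elim: B p d => //=.
- move=> a [|k] p d // _ N [i [t [m [i' [Ev [_ [ii [Ex _]]]]]]]]; case: N.
  by rewrite Ev Ex; apply/vlt_nd; exists 0, i', m; split=> //; left.
- move=> B IHB C IHC p d; rewrite addnS -addSn addnA => le N.
  have leB : (p.+1 + fsize B <= fsize A)%N by apply: leq_trans le; apply: leq_addr.
  case=> [[i [t [Ev H]]]|[H|H]]; last 2 first.
  - by right; left; apply: IHB H.
  - by right; right; apply: IHC H.
  case: N; case: H => -[Ex _]; rewrite Ev Ex; apply: R => //.
  + by apply: leq_trans leB; rewrite -addn1 leq_add2l.
  + by rewrite ltnS leq_addr.
  + by apply: leq_trans le; rewrite -addn1 leq_add2l.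
- move=> B IHB p d; rewrite addnS -addSn => le N [[i [t [y [Ev [Ex _]]]]]|H]; last first.
    by right; apply: IHB H.
  case: N; rewrite Ev Ex; apply: R => //.
  by apply: leq_trans le; rewrite -addn1 leq_add2l.
Qed.

Variable F : num M -> num M.
Hypothesis HF : forall v, search (Phi A 0 0) v F (F v).

Lemma F_neq0 v : F v <> 0 <-> exists x, Phi A 0 0 v x (F x).
Proof.
case: (HF v) => [[-> N]|[x [-> [P _]]]].
  by split=> [//|[x /N]].
by split=> [_|_]; [exists x | apply: num_succ_neq0].
Qed.

(** The value of set variable 0 at stage [i]: subformula number 0 is the whole formula, evaluated at
    the earlier stage [i'] for the number [m]. *)
Definition stage (i : num M) : set (num M) :=
  [set c | exists m i', c = pair m i' /\ (rlt X i' i /\ F (nd 0 i' m) <> 0)].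

(** The search for [A] restricted to the numbers reserved for the occurrence of [B] at [p] is the
    search for [B]; this invariant carries the induction on subformulas. *)
Definition located B p d := forall p' i t x z, (p <= p')%N -> (p' < p + fsize B)%N ->
  Phi A 0 0 (nd (numeral p') i t) x z <-> Phi B p d (nd (numeral p') i t) x z.

Lemma F_sat B p d i t : reduced B -> located B p d ->
  F (nd (numeral p) i t) <> 0 <-> sat (envd d t) (scons (stage i) s0) B.
Proof.
have self C q : (q < q + fsize C)%N by rewrite -addn1 leq_add2l; case: C.
have NP C q d' q' i' t' x z : (q' < q)%N || (q + fsize C <= q')%N ->
    ~ Phi C q d' (nd (numeral q') i' t') x z.
  move=> H /Phi_index [q2 [i2 [t2 [/nd_inj [/numeral_inj <- _ _] h1 h2]]]].
  by move: H; rewrite ltnNge h1 leqNgt h2.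
elim: B p d t => //=.
- move=> a b p d t _ loc; have lc x z := loc p i t x z (leqnn p) (self (Eq a b) p).
  rewrite F_neq0; split=> [[x /lc [i' [t' [/nd_inj [_ _ ->]]]]] //|E].
  by exists 0; apply/lc; exists i, t.
- move=> a b p d t _ loc; have lc x z := loc p i t x z (leqnn p) (self (Lt a b) p).
  rewrite F_neq0; split=> [[x /lc [i' [t' [/nd_inj [_ _ ->]]]]] //|E].
  by exists 0; apply/lc; exists i, t.
- move=> a k p d t _ loc; have lc x z := loc p i t x z (leqnn p) (self (Mem a k) p).
  rewrite F_neq0; case: k lc {loc} => [|k] lc; split.
  + move=> [x /lc [i' [t' [m [i2 [/nd_inj [_ -> ->] [E [ii [Ex Fx]]]]]]]]].
    by exists m, i2; split=> //; split=> //; rewrite -Ex.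
  + move=> [m [i2 [E [ii Fx]]]]; exists (nd 0 i2 m); apply/lc.
    by exists i, t, m, i2.
  + by move=> [x /lc [i' [t' [/nd_inj [_ _ ->]]]]].
  + by move=> E; exists 0; apply/lc; exists i, t.
- move=> B IHB C IHC p d t [rB rC] loc.
  have lc x z := loc p i t x z (leqnn p) (self (Imp B C) p).
  have locB : located B p.+1 d.
    move=> p' i' t' x z h1 h2; rewrite loc /=; last 2 first.
    + exact: ltnW.
    + by apply: leq_trans h2 _; rewrite addSnnS leq_add2l ltnS leq_addr.
    split=> [[[? [? [/nd_inj [/numeral_inj E _ _]]]]|[//|]]|H]; last by right; left.
    + by move: h1; rewrite E ltnn.
    + by case/(NP C); rewrite h2.
  have locC : located C (p.+1 + fsize B) d.
    move=> p' i' t' x z h1 h2; have h0 : (p < p')%N by apply: leq_trans h1; rewrite leq_addr.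
    rewrite loc /=; last 2 first.
    + exact: ltnW.
    + by move: h2; rewrite -addnA addSnnS.
    split=> [[[? [? [/nd_inj [/numeral_inj E _ _]]]]|[|//]]|H]; last by right; right.
    + by move: h0; rewrite E ltnn.
    + by case/(NP B); rewrite h1 orbT.
  rewrite -(IHB _ _ _ rB locB) -(IHC _ _ _ rC locC) F_neq0; split.
    move=> [x /lc [[i' [t' [/nd_inj [_ <- <-]] [[-> E]|[-> H]]]] //|[]]].
      by case/(NP B); rewrite ltnSn.
    by case/(NP C); rewrite addSn ltnS leq_addr.
  move=> H; case: (pselect (F (nd (numeral p.+1) i t) = 0)) => [E|N].
    exists (nd (numeral p.+1) i t); apply/lc.
    by left; exists i, t; split=> //; left.
  exists (nd (numeral (p.+1 + fsize B)) i t); apply/lc.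
  by left; exists i, t; split=> //; right; split=> //; apply: H.
- move=> B IHB p d t rB loc.
  have lc x z := loc p i t x z (leqnn p) (self (ExNum B) p).
  have locB : located B p.+1 d.+1.
    move=> p' i' t' x z h1 h2; rewrite loc /=; last 2 first.
    + exact: ltnW.
    + by rewrite -addSnnS.
    split=> [[[? [? [? [/nd_inj [/numeral_inj E _ _]]]]]|//]|H]; last by right.
    by move: h1; rewrite E ltnn.
  rewrite F_neq0; split=> [[x /lc]|[y]].
    case=> [[i' [t' [y [/nd_inj [_ <- <-] [-> H]]]]]|/(NP B)[]]; last by rewrite ltnSn.
    by exists y; rewrite -envd_pair; apply/(IHB _ _ _ rB locB).
  rewrite -envd_pair => /(IHB _ _ _ rB locB) H.
  exists (nd (numeral p.+1) i (pair y t)); apply/lc.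
  by left; exists i, t, y.
Qed.

End Evaluation.

Lemma iteration A : arithmetical A -> exists2 Y, sets M Y & iterates A e0 s0 X Y.
Proof.
move=> arA; have rA := reduce_reduced arA.
have [|F [dF HF]] := transfinite_search choice (dd_vlt (reduce A)) (@vlt_trans (reduce A))
  (vlt_induction (A := reduce A)) (dd_Phi 0 0 rA).
  by move=> v x z z'; apply: Phi_indep.
pose Y := [set p | exists n j, p = pair n j /\ (field X j /\ F (nd 0 j n) <> 0)].
exists Y; first by apply: dd_comprehension; rewrite /field /=; ddx.
have belowE j : below X Y j = stage F j.
  apply/seteqP; split=> p [m [i]].
    by move=> [ij [n [i' [/pair_inj [<- <-] [_ H]]]] ->]; exists m, i.
  move=> [-> [ij H]]; exists m, i; split=> //; exists m, i; split=> //; split=> //.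
  by case: (rlt_field woX ij).
have E n j : F (nd 0 j n) <> 0 <-> sat (scons n e0) (scons (below X Y j) s0) A.
  rewrite -sat_reduce belowE.
  exact: (@F_sat (reduce A) F HF (reduce A) 0 0 j n rA).
apply/seteqP; split=> p [n [j]].
  by move=> [-> [fj /E H]]; exists n, j.
by move=> [fj /E H ->]; exists n, j.
Qed.

End Iteration.

Theorem proposition10p8 (M : L2structure) :
  RCA0 M -> T2_locally_compact_have_choice M -> ATR M.
Proof.
move=> rca choice A e s arA ss X sX woX.
pose M1 := RcaModel rca.
pose M2 := @AcaModel M1 (fun theta dtheta => @sigma_comprehension M1 choice theta dtheta).
exact: (@iteration M2 choice X sX woX e s ss A arA).
Qed.
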